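(* Let $\mu$ be a positive Borel measure on $(0,\infty)$, let $1\leq p,q\leq\infty$, and let $\phi$ be a weight. Then the following conditions are equivalent. (i) $\mathcal{H}_\mu$ is power bounded on $F_\phi^{p,q}$. (ii) $\mathcal{H}_\mu$ is a contraction on $F_\phi^{p,q}$ (that is, $\mathcal{H}_\mu$ is bounded on $F_\phi^{p,q}$ with $\|\mathcal{H}_\mu\|\le 1$). (iii) $\mu((0,1))=0$ and $\int_{[1,\infty)}\frac{1}{t}\,d\mu(t)\leq 1$. Moreover, in this case, for each $n\in\mathbb{N}$, $$\|\mathcal{H}_\mu^n\|=\|\mathcal{H}_\mu\|^n=\left(\int_{[1,\infty)}\frac{1}{t}\,d\mu(t)\right)^n,$$ where the norms are operator norms on $F_\phi^{p,q}$.
   Context: $H(\mathbb{C})$ denotes the space of entire functions. Let $\phi:[0,\infty)\to\mathbb{R}^+$ be continuously differentiable, extended radially to $\mathbb{C}$ by $\phi(z)=\phi(|z|)$. It is called a weight if $\int_0^\infty e^{-q\phi(r)}r\,dr<\infty$ for the exponent $q$ under consideration, $0<q<\infty$ (when the space considered has $q=\infty$, the integral condition is understood for some finite exponent). For $f\in H(\mathbb{C})$ and $0\le r<\infty$ let $M_p(f,r)=\left(\frac{1}{2\pi}\int_0^{2\pi}|f(re^{i\theta})|^p\,d\theta\right)^{1/p}$ for $0<p<\infty$ and $M_\infty(f,r)=\sup_{|z|=r}|f(z)|$. For $0<p\le\infty$, the weighted mixed norm Fock space $F_\phi^{p,q}$ consists of all $f\in H(\mathbb{C})$ with $\|f\|_{p,q,\phi}<\infty$,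 where $\|f\|_{p,q,\phi}^q=\int_0^\infty M_p^q(f,r)e^{-q\phi(r)}r\,dr$ if $0<q<\infty$, and $\|f\|_{p,\infty,\phi}=\sup_{r\in[0,\infty)}M_p(f,r)e^{-\phi(r)}$ if $q=\infty$. For $1\le p,q\le\infty$ it is a Banach space. For a positive Borel measure $\mu$ on $(0,\infty)$, the Hausdorff operator is defined formally by $\mathcal{H}_\mu f(z)=\int_{(0,\infty)}\frac{1}{t}f\left(\frac{z}{t}\right)d\mu(t)$, $z\in\mathbb{C}$, for $f\in H(\mathbb{C})$. It is bounded on $F_\phi^{p,q}$ if this formula defines a bounded linear operator from $F_\phi^{p,q}$ to itself. A bounded linear operator $T$ on a Banach space is power bounded if $\sup_{n}\|T^n\|<\infty$, where $T^n$ is the $n$th iterate of $T$.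
   Formalization: Adds the hypothesis that all monomials z^n lie in F_φ^{p,q}; without it the equivalence fails, e.g. p=q=2, φ(r)=(3/2)log(2+r), where the space is only the constants and μ=½δ_{1/2} acts as the identity, so (i) and (ii) hold but (iii) fails. *)

(* Defs.v *)
From mathcomp Require Import all_boot all_order all_algebra.
From mathcomp Require Import complex.
From mathcomp Require Import all_classical all_reals all_analysis.

Set Implicit Arguments.
Unset Strict Implicit.
Unset Printing Implicit Defensive.

Import Order.TTheory GRing.Theory Num.Theory.
Import numFieldNormedType.Exports.

Local Open Scope classical_set_scope.
Local Open Scope ring_scope.

Section MixedNormFock.
Context {R : realType}.
Local Notation C := (R[i])%C.
Implicit Types (p q : \bar R) (phi : R -> R) (f : C -> C).

Definition modulus (z : C) : R := ComplexField.Normc.normc z.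

Definition polar (r theta : R) : C := ((r * cos theta) +i* (r * sin theta))%C.

(** Complex differentiability: the scalars of the normed module [C^o] are [C]. *)
Definition entire f : Prop :=
  forall z : C, derivable (f : C^o -> C^o) (z : C^o) (1 : C^o).

(** One-sided at the endpoint [0]; the values of [phi] on the negative reals
    play no role. *)
Definition C1_on_nonneg phi : Prop :=
  exists dphi : R -> R,
    {within `[0, +oo[%classic, continuous dphi} /\
    forall r : R, 0 <= r ->
      (fun s : R => (phi s - phi r) / (s - r))
        @ within [set s | 0 <= s] r^' --> dphi r.

Definition weight_integrable (q : R) phi : Prop :=
  (\int[lebesgue_measure]_(r in `[0%R, +oo[) (expR (- q * phi r) * r)%:E
    < +oo)%E.

(** The weight acts on the plane only through [phi `|z|], so it is kept as a
    function of the radius. *)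
Definition is_weight q phi : Prop :=
  [/\ forall r : R, 0 <= r -> 0 <= phi r,
      C1_on_nonneg phi &
      match q with
      | q'%:E => weight_integrable q' phi
      | _ => exists2 q' : R, 0 < q' & weight_integrable q' phi
      end].

(** The branch [-oo] is a junk value here and in [fock_norm]. *)
Definition circle_mean p f (r : R) : \bar R :=
  match p with
  | p'%:E => (((2 * pi)^-1%:E *
      \int[lebesgue_measure]_(theta in `[0%R, (2 * pi)%R])
         (modulus (f (polar r theta)) `^ p')%:E) `^ p'^-1)%E
  | +oo%E => ereal_sup [set (modulus (f z))%:E | z in [set z | modulus z = r]]
  | -oo%E => 0%E
  end.

Definition fock_norm p q phi f : \bar R :=
  match q with
  | q'%:E => ((\int[lebesgue_measure]_(r in `[0%R, +oo[)
      ((circle_mean p f r `^ q') * (expR (- q' * phi r) * r)%:E)) `^ q'^-1)%E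
  | +oo%E => ereal_sup [set (circle_mean p f r * (expR (- phi r))%:E)%E
                       | r in `[0%R, +oo[]
  | -oo%E => 0%E
  end.

Definition fock p q phi : set (C -> C) :=
  [set f | entire f /\ (fock_norm p q phi f < +oo)%E].

Definition hausdorff_integrand f (z : C) (t : R) : C :=
  (t^-1)%:C%C * f (z / t%:C%C).

(** A Borel measure on [(0, +oo)] is represented by a Borel measure on the real
    line of which only the restriction to [(0, +oo)] is ever used. *)
Definition hausdorff_defined
    (mu : {measure set (measurableTypeR R) -> \bar R}) f : Prop :=
  forall z : C,
    mu.-integrable `]0, +oo[ (fun t => (complex.Re (hausdorff_integrand f z t))%:E) /\
    mu.-integrable `]0, +oo[ (fun t => (complex.Im (hausdorff_integrand f z t))%:E).

(** The complex-valued integral is taken componentwise; it is meaningful under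
    [hausdorff_defined]. *)
Definition hausdorff
    (mu : {measure set (measurableTypeR R) -> \bar R}) f : C -> C :=
  fun z => ((\int[mu]_(t in `]0, +oo[) complex.Re (hausdorff_integrand f z t))
       +i* (\int[mu]_(t in `]0, +oo[) complex.Im (hausdorff_integrand f z t)))%C.

Definition bounded_operator (F : set (C -> C)) (nrm : (C -> C) -> \bar R)
    (T : (C -> C) -> (C -> C)) : Prop :=
  [/\ forall f, F f -> F (T f),
      forall (a : C) f g, F f -> F g ->
        T (fun z => a * f z + g z) = (fun z => a * T f z + T g z) &
      exists M : R, forall f, F f -> (nrm (T f) <= M%:E * nrm f)%E].

Definition operator_norm (F : set (C -> C)) (nrm : (C -> C) -> \bar R)
    (T : (C -> C) -> (C -> C)) : \bar R :=
  ereal_sup [set nrm (T f) | f in [set f | F f /\ (nrm f <= 1)%E]].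

Definition fock_operator_norm p q phi (T : (C -> C) -> (C -> C)) : \bar R :=
  operator_norm (fock p q phi) (fock_norm p q phi) T.

Definition hausdorff_bounded p q phi
    (mu : {measure set (measurableTypeR R) -> \bar R}) : Prop :=
  (forall f, fock p q phi f -> hausdorff_defined mu f) /\
  bounded_operator (fock p q phi) (fock_norm p q phi) (hausdorff mu).

Definition hausdorff_power_bounded p q phi
    (mu : {measure set (measurableTypeR R) -> \bar R}) : Prop :=
  hausdorff_bounded p q phi mu /\
  (ereal_sup [set fock_operator_norm p q phi (iter n (hausdorff mu))
             | n in [set: nat]] < +oo)%E.

Definition hausdorff_contraction p q phi
    (mu : {measure set (measurableTypeR R) -> \bar R}) : Prop :=
  hausdorff_bounded p q phi mu /\
  (fock_operator_norm p q phi (hausdorff mu) <= 1)%E.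

End MixedNormFock.

(* Main.v *)
Require Import Defs.
From HB Require Import structures.
From mathcomp Require Import all_boot all_order all_algebra.
From mathcomp Require Import complex ring lra.
From mathcomp Require Import all_classical all_reals all_analysis.
From mathcomp Require Import measurable_realfun.

Set Implicit Arguments.
Unset Strict Implicit.
Unset Printing Implicit Defensive.

Import Order.TTheory GRing.Theory Num.Theory.
Import numFieldNormedType.Exports.

Local Open Scope classical_set_scope.
Local Open Scope ring_scope.

(** Write [H] for the Hausdorff operator of [mu].

    The necessity of the condition on [mu] comes from monomials. They are
    eigenvectors: [H] multiplies [z ^+ n] by the moment
    [c_n], the integral of [t^-(n+1)] over [(0, +oo)]
    ([hausdorff_monomial]). Their norms are finite by assumption and positive
    ([fock_norm_monomial_gt0]), so the norm of the [m]-th iterate is at least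
    [c_n ^+ m] ([operator_norm_ge_moment]). If [H] is power bounded or a
    contraction, then [c_n <= 1] for every [n]. As [t^-(n+1)] tends to infinity
    on [(0, 1)], this forces [mu] to vanish there ([moments_bounded_null]), and
    [c_0 <= 1] is the bound on the integral of [1 / t].

    Conversely, let [mu] vanish on [(0, 1)] and let [K <= 1] be the integral of
    [1 / t] over [[1, +oo)]. On the circle of radius [r], [H f] is an average,
    with total weight [K], of the functions [f (z / t)] with [t >= 1]. By
    Minkowski's integral inequality ([average_Lp]) its mean is at most [K]
    times the largest mean of [f] over the circles of radius [r / t <= r], and
    the means of an entire function increase with the radius
    ([Lp_circle_mono]). Hence every circle mean of [H f] is at most [K] times
    that of [f] ([circle_mean_hausdorff]), and the same holds for the norms,
    whatever the weight. The constants show that [K] is the exact norm of [H]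
    and that [K ^+ n] is the exact norm of its iterates
    ([operator_norm_iter_hausdorff]).

    The function theory starts from the bare existence of the complex
    derivative. Goursat's theorem on rectangles ([goursat_rectangle]), applied
    to [F] composed with the exponential, shows that the mean of [F] over a
    circle around 0 does not depend on the radius, so that it equals the value
    at the centre ([circle_mean_value]). Three consequences are drawn.
    - For [F] the composition of [f] with an automorphism of a disc, the mean
      value property expresses [f] at an interior point as a mean of its values
      on the circle. This gives the maximum principle. It also gives the
      monotonicity of the means: when the interior point runs through a smaller
      circle, the points of the large circle that enter the mean move by
      rotations, under which the means are invariant.
    - For [F] a difference quotient of [f], one gets Cauchy's estimate
      ([cauchy_estimate]).
    - Applying this estimate to [f] and to its increments gives a second order
      Taylor estimate, uniform on discs ([entire_taylor]), by which one can
      differentiate under the integral sign: [H f] is entire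
      ([entire_hausdorff]). *)

Arguments modulus {R} z : simpl never.

(** * Complex differentiability in terms of moduli *)

Section ComplexModulus.
Context {R : realType}.
Local Notation C := (R[i])%C.
Implicit Types (z w k d : C) (f g : C -> C).

Lemma modulus_ge0 z : 0 <= modulus z.
Proof. by case: z => a b; exact: sqrtr_ge0. Qed.

Lemma modulusM z w : modulus (z * w) = modulus z * modulus w.
Proof. exact: ComplexField.Normc.normcM. Qed.

Lemma modulusD z w : modulus (z + w) <= modulus z + modulus w.
Proof. exact: le_normcD. Qed.

Lemma modulusN z : modulus (- z) = modulus z.
Proof. exact: normcN. Qed.

Lemma modulusB z w : modulus (z - w) <= modulus z + modulus w.
Proof. by rewrite -(modulusN w); exact: modulusD. Qed.

Lemma modulus_distC z w : modulus (z - w) = modulus (w - z).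
Proof. by rewrite -modulusN opprB. Qed.

Lemma modulus0 : modulus (0 : C) = 0.
Proof. exact: ComplexField.Normc.normc0. Qed.

Lemma modulus1 : modulus (1 : C) = 1.
Proof. exact: ComplexField.Normc.normc1. Qed.

Lemma modulus0_eq z : modulus z = 0 -> z = 0.
Proof. exact: ComplexField.Normc.eq0_normc. Qed.

Lemma modulus_gt0 z : (0 < modulus z) = (z != 0).
Proof.
rewrite lt_neqAle modulus_ge0 andbT eq_sym.
apply/idP/idP; apply: contra => /eqP; first by move=> ->; rewrite modulus0.
by move/modulus0_eq => ->.
Qed.

Lemma modulusV z : modulus z^-1 = (modulus z)^-1.
Proof. exact: ComplexField.Normc.normcV. Qed.

Lemma modulusX z n : modulus (z ^+ n) = modulus z ^+ n.
Proof.
elim: n => [|n IH]; first by rewrite !expr0 modulus1.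
by rewrite !exprS modulusM IH.
Qed.

Lemma modulus_real (x : R) : modulus (x%:C%C) = `|x|.
Proof. by rewrite /modulus /= expr0n addr0 sqrtr_sqr. Qed.

Lemma modulus_nneg (x : R) : 0 <= x -> modulus (x%:C%C) = x.
Proof. by move=> x0; rewrite modulus_real ger0_norm. Qed.

Lemma normC_modulus z : `|z| = (modulus z)%:C%C.
Proof. by []. Qed.

Lemma Re_le_modulus z : `|complex.Re z| <= modulus z.
Proof.
case: z => a b; rewrite /modulus /=.
by rewrite -sqrtr_sqr ler_wsqrtr// lerDl sqr_ge0.
Qed.

Lemma Im_le_modulus z : `|complex.Im z| <= modulus z.
Proof.
case: z => a b; rewrite /modulus /=.
by rewrite -sqrtr_sqr ler_wsqrtr// lerDr sqr_ge0.
Qed.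

Lemma modulus_le_ReIm z : modulus z <= `|complex.Re z| + `|complex.Im z|.
Proof.
rewrite [in leLHS](complexE z).
rewrite (le_trans (modulusD _ _))// modulusM !modulus_real.
by rewrite /modulus/= expr0n expr1n add0r sqrtr1 mul1r.
Qed.

Lemma modulus_sqr z :
  modulus z ^+ 2 = complex.Re z ^+ 2 + complex.Im z ^+ 2.
Proof. by case: z => a b; rewrite sqr_sqrtr// addr_ge0 ?sqr_ge0. Qed.

Lemma modulus_le_dist z w : modulus z <= modulus w + modulus (z - w).
Proof. by rewrite -[in leLHS](subrK w z) addrC; exact: modulusD. Qed.

Lemma modulus_lip z w : `|modulus z - modulus w| <= modulus (z - w).
Proof.
rewrite ler_norml; have := modulus_le_dist z w; have := modulus_le_dist w z.
rewrite (modulus_distC w); lra.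
Qed.

Lemma modulus_polar (r t : R) : 0 <= r -> modulus (polar r t) = r.
Proof.
move=> r0; rewrite /polar /modulus /= !exprMn -mulrDr cos2Dsin2 mulr1.
by rewrite sqrtr_sqr ger0_norm.
Qed.

Lemma modulus_conj z : modulus (conjc z) = modulus z.
Proof. by case: z => a b; rewrite /modulus /= sqrrN. Qed.

Lemma polarM (r s t u : R) : polar r t * polar s u = polar (r * s) (t + u).
Proof.
rewrite /polar cosD sinD; apply/eqP; rewrite eq_complex /=.
by apply/andP; split; apply/eqP; ring.
Qed.

Lemma polarE (r t : R) : polar r t = r%:C%C * polar 1 t.
Proof.
by rewrite /polar; apply/eqP; rewrite eq_complex /= !mul0r subr0 addr0 !mul1r !eqxx.
Qed.

Lemma polar_at0 (r : R) : polar r 0 = r%:C%C.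
Proof. by rewrite /polar cos0 sin0 mulr1 mulr0. Qed.

(** Complex differentiability with prescribed derivative, as a quantitative
    statement about moduli: this is the form in which it enters integral
    estimates. *)
Definition cdiff f z d := forall e : R, 0 < e -> exists2 a : R, 0 < a &
  forall k, modulus k < a -> modulus (f (z + k) - f z - d * k) <= e * modulus k.

(** Continuity in the same form, so that the moduli of complex numbers stay real
    numbers throughout. *)
Definition ccont f z := forall e : R, 0 < e -> exists2 a : R, 0 < a &
  forall k, modulus k < a -> modulus (f (z + k) - f z) < e.

Lemma cdiff_lip f z d : cdiff f z d -> exists2 a : R, 0 < a &
  forall k, modulus k < a -> modulus (f (z + k) - f z) <= (modulus d + 1) * modulus k.
Proof.
move=> /(_ 1 ltr01)[a a0 fa]; exists a => // k /fa H.
have -> : f (z + k) - f z = (f (z + k) - f z - d * k) + d * k by ring.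
have := modulusD (f (z + k) - f z - d * k) (d * k).
rewrite modulusM; lra.
Qed.

Lemma cdiff_ccont f z d : cdiff f z d -> ccont f z.
Proof.
move=> /cdiff_lip[a a0 fa] e e0.
have d1 : 0 < modulus d + 1 by have := modulus_ge0 d; lra.
exists (Num.min a (e / (modulus d + 1))).
  by rewrite lt_min a0 divr_gt0.
move=> k; rewrite lt_min => /andP[ka]; rewrite ltr_pdivlMr// mulrC => ke.
exact: le_lt_trans (fa _ ka) ke.
Qed.

Lemma cdiff_cst c z : cdiff (fun=> c) z 0.
Proof.
move=> e e0; exists 1 => // k _.
by rewrite subrr mul0r subr0 modulus0 mulr_ge0 ?modulus_ge0// ltW.
Qed.

Lemma cdiff_id z : cdiff (fun w => w) z 1.
Proof.
move=> e e0; exists 1 => // k _.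
have -> : z + k - z - 1 * k = 0 by ring.
by rewrite modulus0 mulr_ge0 ?modulus_ge0// ltW.
Qed.

Lemma cdiffD f g z d d' : cdiff f z d -> cdiff g z d' ->
  cdiff (fun w => f w + g w) z (d + d').
Proof.
move=> fd gd e e0; have e2 : 0 < e / 2 by lra.
have [a a0 fa] := fd _ e2; have [b b0 gb] := gd _ e2.
exists (Num.min a b); first by rewrite lt_min a0.
move=> k; rewrite lt_min => /andP[/fa ka /gb kb].
have -> : f (z + k) + g (z + k) - (f z + g z) - (d + d') * k =
  (f (z + k) - f z - d * k) + (g (z + k) - g z - d' * k) by ring.
by rewrite (le_trans (modulusD _ _))//; lra.
Qed.

Lemma cdiff_comp f g z d d' : cdiff f z d -> cdiff g (f z) d' ->
  cdiff (fun w => g (f w)) z (d' * d).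
Proof.
move=> fd gd e e0.
have [b b0 fb] := cdiff_lip fd.
have D1 : 0 < modulus d + 1 by have := modulus_ge0 d; lra.
have D2 : 0 < modulus d' + 1 by have := modulus_ge0 d'; lra.
have [c c0 gc] := gd (e / 2 / (modulus d + 1)) ltac:(by rewrite !divr_gt0).
have [a a0 fa] := fd (e / 2 / (modulus d' + 1)) ltac:(by rewrite !divr_gt0).
exists (Num.min a (Num.min b (c / (modulus d + 1)))).
  by rewrite !lt_min a0 b0 divr_gt0.
move=> k; rewrite !lt_min ltr_pdivlMr// => /and3P[ka kb kc].
set h := f (z + k) - f z.
have hk : modulus h <= (modulus d + 1) * modulus k by exact: fb.
have /gc : modulus h < c by rewrite (le_lt_trans hk)// mulrC.
have -> : f z + h = f (z + k) by rewrite /h addrC subrK.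
have := fa _ ka; rewrite -/h => H1 H2.
have -> : g (f (z + k)) - g (f z) - d' * d * k =
   (g (f (z + k)) - g (f z) - d' * h) + d' * (h - d * k) by ring.
rewrite (le_trans (modulusD _ _))// modulusM.
have H3 : e / 2 / (modulus d + 1) * modulus h <= e / 2 * modulus k.
  rewrite (le_trans (ler_wpM2l _ hk)) ?divr_ge0 ?(ltW e0) ?(ltW D1)//.
  by rewrite mulrA divfK ?gt_eqF.
have H4 : modulus d' * modulus (h - d * k) <= e / 2 * modulus k.
  rewrite (@le_trans _ _ ((modulus d' + 1) * (e / 2 / (modulus d' + 1) * modulus k)))//.
    by apply: ler_pM; rewrite ?modulus_ge0//; lra.
  by rewrite mulrA mulrCA divff ?mulr1 ?gt_eqF.
lra.
Qed.

Lemma cdiff_inv z : z != 0 -> cdiff (fun w => w^-1) z (- z^-2).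
Proof.
move=> z0 e e0; have mz : 0 < modulus z by rewrite modulus_gt0.
exists (Num.min (modulus z / 2) (e * modulus z ^+ 3 / 2)).
  by rewrite lt_min !divr_gt0 ?mulr_gt0 ?exprn_gt0.
move=> k; rewrite lt_min => /andP[kz ke].
have zk : modulus z / 2 <= modulus (z + k).
  have := modulus_le_dist z (z + k).
  by rewrite opprD addNKr modulusN; lra.
have zk0 : z + k != 0 by rewrite -modulus_gt0; lra.
have -> : (z + k)^-1 - z^-1 - - z^-2 * k = k * k / (z ^+ 2 * (z + k)).
  by field; rewrite z0 zk0.
rewrite !modulusM modulusV modulusM modulusX -mulrA mulrC.
rewrite ler_wpM2r ?modulus_ge0// ler_pdivrMr; last first.
  by rewrite mulr_gt0 ?exprn_gt0//; lra.
rewrite (le_trans (ltW ke))// -!mulrA ler_wpM2l ?(ltW e0)//.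
by rewrite !ler_wpM2l ?(ltW mz).
Qed.

Lemma cdiffM f g z d d' : cdiff f z d -> cdiff g z d' ->
  cdiff (fun w => f w * g w) z (d * g z + f z * d').
Proof.
move=> fd gd e e0.
have [b b0 fb] := cdiff_lip fd.
have D1 : 0 < modulus d + 1 by have := modulus_ge0 d; lra.
have D2 : 0 < modulus (g z) + 1 by have := modulus_ge0 (g z); lra.
have D3 : 0 < modulus (f z) + 1 by have := modulus_ge0 (f z); lra.
have [a a0 fa] := fd (e / 3 / (modulus (g z) + 1)) ltac:(by rewrite !divr_gt0).
have [c c0 gc] := gd (e / 3 / (modulus (f z) + 1)) ltac:(by rewrite !divr_gt0).
have [c' c'0 gc'] := cdiff_ccont gd
  (e := e / 3 / (modulus d + 1)) ltac:(by rewrite !divr_gt0).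
exists (Num.min (Num.min a b) (Num.min c c')).
  by rewrite !lt_min a0 b0 c0 c'0.
move=> k; rewrite !lt_min => /andP[/andP[ka kb] /andP[kc kc']].
have -> : f (z + k) * g (z + k) - f z * g z - (d * g z + f z * d') * k =
   (f (z + k) - f z - d * k) * g z + f z * (g (z + k) - g z - d' * k)
   + (f (z + k) - f z) * (g (z + k) - g z) by ring.
apply: (le_trans (modulusD _ _)).
have -> : e * modulus k = (e / 3 * modulus k + e / 3 * modulus k) + e / 3 * modulus k.
  by field.
apply: lerD; first apply: (le_trans (modulusD _ _)); first apply: lerD.
- rewrite modulusM; apply: (@le_trans _ _ ((e / 3 / (modulus (g z) + 1) * modulus k)
    * (modulus (g z) + 1))).
    by apply: ler_pM; rewrite ?modulus_ge0 ?fa//; lra.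
  by rewrite mulrAC divfK ?gt_eqF.
- rewrite modulusM; apply: (@le_trans _ _ ((modulus (f z) + 1) *
      (e / 3 / (modulus (f z) + 1) * modulus k))).
    by apply: ler_pM; rewrite ?modulus_ge0 ?gc//; lra.
  by rewrite mulrA mulrCA divff ?mulr1 ?gt_eqF.
- rewrite modulusM; apply: (@le_trans _ _ ((modulus d + 1) * modulus k *
      (e / 3 / (modulus d + 1)))).
    by apply: ler_pM; rewrite ?modulus_ge0 ?fb// ltW// gc'.
  by rewrite mulrC mulrA divfK ?gt_eqF.
Qed.

Lemma cdiffZ f c z d : cdiff f z d -> cdiff (fun w => c * f w) z (c * d).
Proof. by move=> fd; have := cdiffM (cdiff_cst c z) fd; rewrite mul0r add0r. Qed.

Lemma cdiffB f g z d d' : cdiff f z d -> cdiff g z d' ->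
  cdiff (fun w => f w - g w) z (d - d').
Proof.
move=> fd /(cdiffZ (-1)) gd; rewrite -(mulN1r d').
have -> : (fun w => f w - g w) = (fun w => f w + -1 * g w).
  by apply/funext => w; rewrite mulN1r.
exact: cdiffD.
Qed.

Lemma cdiff_shift f z h d : cdiff f (z + h) d -> cdiff (fun w => f (w + h)) z d.
Proof.
move=> fd e /fd[a a0 aP]; exists a => // k /aP.
by rewrite (addrAC z k).
Qed.

(** The norm of [C] as a normed module over itself is the modulus, viewed as a
    complex number; the lemma moves between the two readings of the limit of
    the difference quotient. *)
Lemma entireP f : entire f <-> forall z, exists d, cdiff f z d.
Proof.
split=> [fe z|fd z].
- have /cvg_ex[/= d fzd] := fe z.
  exists d => e e0.
  have /cvgrPdist_le/(_ (e%:C%C)) := fzd.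
  rewrite ltcR => /(_ e0).
  rewrite nearE /=; case; move=> a /= a0 aP.
  move: (a0); rewrite ltcE /= => /andP[/eqP Ia Ra].
  exists (complex.Re a) => // k ka.
  have [->|k0] := eqVneq k 0.
    by rewrite addr0 subrr mulr0 subr0 modulus0 mulr0.
  have := aP k; rewrite /ball_ /= sub0r normrN normC_modulus.
  have -> : ((modulus k)%:C%C < a) by rewrite ltcE /= Ia eqxx.
  move=> /(_ isT k0); rewrite normC_modulus lecR.
  rewrite /GRing.scale /= mulr1 (addrC k).
  move=> H; have mk : 0 < modulus k by rewrite modulus_gt0.
  rewrite -ler_pdivrMr// -modulusV -modulusM modulus_distC in H *.
  apply: le_trans H; rewrite le_eqVlt; apply/orP; left; apply/eqP.
  congr modulus; by field.
- have [d fzd] := fd z.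
  apply/cvg_ex; exists d; apply/cvgrPdist_le => /= e.
  rewrite ltcE /= => /andP[/eqP Ie Re0].
  have [a a0 aP] := fzd _ Re0.
  rewrite nearE /=; exists (a%:C%C); first by rewrite /= ltcR.
  move=> k /=; rewrite sub0r normrN normC_modulus ltcR => ka k0.
  have := aP _ ka.
  have mk : 0 < modulus k by rewrite modulus_gt0.
  rewrite -ler_pdivrMr// -modulusV -modulusM => H.
  rewrite normC_modulus lecE /= Ie eqxx /= modulus_distC.
  apply: le_trans H; rewrite le_eqVlt; apply/orP; left; apply/eqP.
  congr modulus; rewrite /GRing.scale /= mulr1 (addrC k); by field.
Qed.

End ComplexModulus.

(** * The complex exponential and polar coordinates *)

Section ComplexExponential.
Context {R : realType}.
Local Notation C := (R[i])%C.
Implicit Types (z w k d : C) (f g : C -> C).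

Definition cexp w : C := polar (expR (complex.Re w)) (complex.Im w).

Lemma cexpD z w : cexp (z + w) = cexp z * cexp w.
Proof. by rewrite /cexp polarM -expRD; case: z w => a b [c d]. Qed.

Lemma modulus_cexp w : modulus (cexp w) = expR (complex.Re w).
Proof. by rewrite modulus_polar// expR_ge0. Qed.

Lemma is_derive_linear_approx (u : R -> R) (x l : R) : is_derive x 1 u l ->
  forall e : R, 0 < e -> exists2 a : R, 0 < a &
  forall h : R, `|h| < a -> `|u (x + h) - u x - l * h| <= e * `|h|.
Proof.
move=> [du <-] e e0; have := derivable_nbhs du.
move/cvg_ex : du => [/= d fzd].
have -> : 'D_1 u x = d by apply/cvg_lim.
move/cvgrPdist_le/(_ _ e0) : fzd; rewrite nearE /=; case; move=> a /= a0 aP _.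
exists a => // k ka.
have [->|k0] := eqVneq k 0.
  by rewrite addr0 subrr mulr0 subr0 normr0 mulr0.
have := aP k; rewrite /ball_ /= sub0r normrN => /(_ ka k0).
rewrite /GRing.scale /= mulr1 (addrC k) => H.
have mk : 0 < `|k| by rewrite normr_gt0.
rewrite -ler_pdivrMr// -normfV -normrM distrC in H *.
apply: le_trans H; rewrite le_eqVlt; apply/orP; left; apply/eqP.
by congr (`| _ |); field.
Qed.

Lemma cexp0 : cexp 0 = 1.
Proof. by rewrite /cexp /= expR0 polar_at0. Qed.

(** With [k = x + i y] and [u = cos y + i sin y], the remainder is
    [(exp x - 1 - x) u + (1 + x) (u - 1 - i y) + i x y], and each factor is
    controlled by the derivative at 0 of a real function. *)
Lemma cdiff_cexp0 : cdiff cexp 0 1.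
Proof.
(* The bounds [A1] to [A5] below add up to [7 * (e / 8 * m)]. *)
move=> e e0; have e3 : 0 < e / 8 by lra.
have [a a0 aP] := is_derive_linear_approx (is_derive_expR (0 : R)) e3.
have [b b0 bP] := is_derive_linear_approx (is_derive_cos (0 : R)) e3.
have [c c0 cP] := is_derive_linear_approx (is_derive_sin (0 : R)) e3.
exists (Num.min (Num.min a b) (Num.min c (Num.min 1 (e / 8)))).
  by rewrite !lt_min a0 b0 c0 e3 ltr01.
move=> k; have := Re_le_modulus k; have := Im_le_modulus k.
have := modulus_ge0 k; rewrite !lt_min add0r cexp0 mul1r.
set m := modulus k; clearbody m; case: k => x y /= m0 ym xm /andP[/andP[ma mb] /and3P[mc m1 me]].
have {aP}/aP : `|x| < a by lra.
have {bP}/bP : `|y| < b by lra.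
have {cP}/cP : `|y| < c by lra.
rewrite !add0r expR0 sin0 cos0 oppr0 !mul0r !subr0 !mul1r => H1 H2 H3.
rewrite /cexp /polar /=; set E := expR x; rewrite -/E in H3.
apply: le_trans (modulus_le_ReIm _) _ => /=.
have -> : E * cos y - 1 - x = (E - 1 - x) * cos y + (1 + x) * (cos y - 1) by ring.
have -> : E * sin y - 0 - y = (E - 1 - x) * sin y + (1 + x) * (sin y - y) + x * y.
  by ring.
have em : e * m = 8 * (e / 8 * m) by field.
have x1 : `|1 + x| <= 2.
  by apply: (le_trans (ler_normD _ _)); rewrite normr1; lra.
have A1 : `|(E - 1 - x) * cos y| <= e / 8 * m.
  rewrite normrM -[leRHS]mulr1; apply: ler_pM => //; last exact: cos_max.
  by apply: le_trans H3 _; rewrite ler_pM2l.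
have A2 : `|(E - 1 - x) * sin y| <= e / 8 * m.
  rewrite normrM -[leRHS]mulr1; apply: ler_pM => //; last exact: sin_max.
  by apply: le_trans H3 _; rewrite ler_pM2l.
have A3 : `|(1 + x) * (cos y - 1)| <= 2 * (e / 8 * m).
  rewrite normrM; apply: ler_pM => //.
  by rewrite (le_trans H2)// ler_pM2l.
have A4 : `|(1 + x) * (sin y - y)| <= 2 * (e / 8 * m).
  rewrite normrM; apply: ler_pM => //.
  by rewrite addr0 in H1; rewrite (le_trans H1)// ler_pM2l.
have A5 : `|x * y| <= e / 8 * m.
  rewrite normrM; apply: ler_pM => //; lra.
have := ler_normD ((E - 1 - x) * cos y) ((1 + x) * (cos y - 1)).
have := ler_normD ((E - 1 - x) * sin y + (1 + x) * (sin y - y)) (x * y).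
have := ler_normD ((E - 1 - x) * sin y) ((1 + x) * (sin y - y)).
have := mulr_ge0 (ltW e3) m0.
lra.
Qed.

Lemma cdiff_cexp w : cdiff cexp w (cexp w).
Proof.
move=> e e0; have M0 : 0 < modulus (cexp w) by rewrite modulus_cexp expR_gt0.
have [a a0 aP] := cdiff_cexp0 (divr_gt0 e0 M0); exists a => // k /aP.
rewrite add0r cexp0 cexpD mul1r => H.
have -> : cexp w * cexp k - cexp w - cexp w * k = cexp w * (cexp k - 1 - k) by ring.
rewrite modulusM; apply: le_trans (ler_wpM2l (ltW M0) H) _.
by rewrite mulrA mulrCA divff ?mulr1 ?gt_eqF.
Qed.

Lemma polar1E t : polar 1 t = cexp (0 +i* t)%C.
Proof. by rewrite /cexp /= expR0. Qed.

(** The argument of [x + i y] is [acos (x / r)] in the upper half-plane and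
    [2 pi - acos (x / r)] in the lower one. *)
Lemma polar_surj z : exists2 t : R, 0 <= t <= 2 * pi & z = polar (modulus z) t.
Proof.
have [->|z0] := eqVneq z 0.
  by exists 0; rewrite ?lexx ?mulr_ge0 ?pi_ge0// modulus0 polar_at0.
have m0 : 0 < modulus z by rewrite modulus_gt0.
have := modulus_sqr z; have := Re_le_modulus z; move: m0.
set r := modulus z; clearbody r; case: z z0 => x y z0 r0 xr rE; rewrite /= in xr rE.
have X : -1 <= x / r <= 1.
  move: xr; rewrite ler_norml => /andP[x1 x2].
  by rewrite ler_pdivlMr// ler_pdivrMr// mulN1r mul1r x1.
have S : sin (acos (x / r)) = `|y| / r.
  rewrite sin_acos//; apply: (@pexpIrn _ 2) => //; rewrite ?nnegrE ?sqrtr_ge0//.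
    by rewrite divr_ge0// ltW.
  rewrite sqr_sqrtr; last by rewrite subr_ge0; case/andP: X => *; nra.
  rewrite !exprMn real_normK ?num_real// exprVn.
  have -> : y ^+ 2 = r ^+ 2 - x ^+ 2 by rewrite rE; ring.
  by field; rewrite gt_eqF.
have /andP[P0 P1] : 0 <= acos (x / r) <= (pi : R) by rewrite acos_ge0// acos_lepi.
have [y0|y0] := leP 0 y.
  exists (acos (x / r)); first by lra.
  rewrite /polar acosK ?in_itv// S ger0_norm//.
  by congr Complex; field; rewrite gt_eqF.
exists (2 * pi - acos (x / r)); first by lra.
rewrite /polar.
have -> : 2 * pi - acos (x / r) = - acos (x / r) + pi *+ 2 by rewrite mulr2n; ring.
rewrite cosD2pi sinD2pi cosN sinN acosK ?in_itv// S ltr0_norm//.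
by congr Complex; field; rewrite gt_eqF.
Qed.

End ComplexExponential.

Section Curves.
Context {R : realType}.
Local Notation C := (R[i])%C.
Implicit Types (F G : R -> C) (f : C -> C) (t : R).

Definition curve_cont F t := forall e : R, 0 < e -> exists2 a : R, 0 < a &
  forall s, `|s - t| < a -> modulus (F s - F t) < e.

Lemma curve_cont_comp f F t :
  ccont f (F t) -> curve_cont F t -> curve_cont (f \o F) t.
Proof.
move=> cf cF e e0; have [b b0 bP] := cf _ e0; have [a a0 aP] := cF _ b0.
exists a => // s /aP/bP /=.
by have -> : F t + (F s - F t) = F s by ring.
Qed.

Lemma continuous_dominated (u : R -> R) F t : curve_cont F t ->
  (forall s, `|u s - u t| <= modulus (F s - F t)) -> {for t, continuous u}.
Proof.
move=> cF uF; apply/cvgrPdist_lt => e e0.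
have [a a0 aP] := cF _ e0; exists a => // s /= ts.
rewrite distrC (le_lt_trans (uF s))// aP// distrC; exact: ts.
Qed.

Lemma curve_cont_Re F t : curve_cont F t ->
  {for t, continuous (fun s => complex.Re (F s))}.
Proof.
move=> cF; apply: (continuous_dominated cF) => s; rewrite -raddfB.
exact: Re_le_modulus.
Qed.

Lemma curve_cont_Im F t : curve_cont F t ->
  {for t, continuous (fun s => complex.Im (F s))}.
Proof.
move=> cF; apply: (continuous_dominated cF) => s; rewrite -raddfB.
exact: Im_le_modulus.
Qed.

Lemma curve_cont_modulus F t : curve_cont F t ->
  {for t, continuous (fun s => modulus (F s))}.
Proof. by move=> cF; apply: (continuous_dominated cF) => s; exact: modulus_lip. Qed.

Lemma curve_cont_real (u : R -> R) t : {for t, continuous u} ->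
  curve_cont (fun s => (u s)%:C%C) t.
Proof.
move=> cu e e0; move/cvgrPdist_lt/(_ _ e0): cu; rewrite nearE /= => -[a a0 aP].
exists a => // s st; rewrite -raddfB modulus_real distrC; apply: aP.
by rewrite /ball_ /= distrC.
Qed.

Lemma curve_cont_line w d t : curve_cont (fun s => w + s%:C%C * d) t.
Proof.
move=> e e0; have D : 0 < modulus d + 1 by have := modulus_ge0 d; lra.
exists (e / (modulus d + 1)); first by rewrite divr_gt0.
move=> s; rewrite ltr_pdivlMr// => H.
have -> : w + s%:C%C * d - (w + t%:C%C * d) = (s - t)%:C%C * d.
  by rewrite raddfB /=; ring.
rewrite modulusM modulus_real; apply: le_lt_trans H.
by rewrite ler_wpM2l// lerDl.
Qed.

Lemma curve_cont_polar1 t : curve_cont (polar 1) t.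
Proof.
have -> : polar 1 = cexp \o (fun s : R => 0 + s%:C%C * 'i%C).
  apply/funext => s /=; rewrite polar1E; congr cexp; rewrite add0r.
  by apply/eqP; rewrite eq_complex /= !(mulr0, mul0r, mulr1, subr0, addr0) !eqxx.
by apply: curve_cont_comp; [exact: cdiff_ccont (cdiff_cexp _)|exact: curve_cont_line].
Qed.

Lemma ccontMl c z : ccont (fun w : C => c * w) z.
Proof. by apply: cdiff_ccont (cdiffZ c (cdiff_id z)). Qed.

Lemma curve_cont_circle z (c : C) t : curve_cont (fun s => z + c * polar 1 s) t.
Proof.
apply: (@curve_cont_comp (fun w => z + c * w) (polar 1)); last exact: curve_cont_polar1.
exact: cdiff_ccont (cdiffD (cdiff_cst z _) (cdiffZ c (cdiff_id _))).
Qed.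

Lemma curve_cont_polar r t : curve_cont (polar r) t.
Proof.
have -> : polar r = (fun s => 0 + r%:C%C * polar 1 s).
  by apply/funext => s; rewrite add0r -polarE.
exact: curve_cont_circle.
Qed.

End Curves.

(** * Integrals of complex-valued functions *)

Section ComplexIntegral.
Context {R : realType} d (T : measurableType d) (mu : {measure set T -> \bar R}).
Variables (D : set T) (mD : measurable D).
Local Notation C := (R[i])%C.
Implicit Types (F G : T -> C) (c : C).

Definition cintegral F : C :=
  ((\int[mu]_(t in D) complex.Re (F t)) +i* (\int[mu]_(t in D) complex.Im (F t)))%C.

Definition cintegrable F : Prop :=
  mu.-integrable D (fun t => (complex.Re (F t))%:E) /\
  mu.-integrable D (fun t => (complex.Im (F t))%:E).

Lemma cintegrable_dominated F (g : T -> R) :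
  measurable_fun D (fun t => complex.Re (F t)) ->
  measurable_fun D (fun t => complex.Im (F t)) ->
  (forall t, D t -> modulus (F t) <= g t) ->
  mu.-integrable D (EFin \o g) -> cintegrable F.
Proof.
move=> mRe mIm Fg ig; have mE (u : T -> R) : measurable_fun D u ->
    (forall t, D t -> `|u t| <= modulus (F t)) ->
    mu.-integrable D (fun t => (u t)%:E).
  move=> mu_ uF; apply: (le_integrable mD _ _ ig); first exact/measurable_EFinP.
  move=> t Dt /=; rewrite lee_fin (le_trans (uF _ Dt))//.
  by rewrite (le_trans (Fg _ Dt))// ler_norm.
by split; apply: mE => // t _; [exact: Re_le_modulus|exact: Im_le_modulus].
Qed.

Lemma cintegrableZ c F : cintegrable F -> cintegrable (fun t => c * F t).
Proof.
case=> iRe iIm; case: c => a b; split.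
- rewrite (_ : (fun t => _) =
    ((fun t => a%:E * (complex.Re (F t))%:E) \- (fun t => b%:E * (complex.Im (F t))%:E))%E).
    by apply: integrableB => //; exact: integrableZl.
  by apply/funext => t; rewrite -!EFinM -EFinB; congr EFin; case: (F t).
- rewrite (_ : (fun t => _) =
    ((fun t => a%:E * (complex.Im (F t))%:E) \+ (fun t => b%:E * (complex.Re (F t))%:E))%E).
    by apply: integrableD => //; exact: integrableZl.
  by apply/funext => t; rewrite -!EFinM -EFinD; congr EFin; case: (F t).
Qed.

Lemma cintegrableD F G : cintegrable F -> cintegrable G ->
  cintegrable (fun t => F t + G t).
Proof.
move=> [Fr Fi] [Gr Gi]; split.
- rewrite (_ : (fun t => _) =
    ((fun t => (complex.Re (F t))%:E) \+ (fun t => (complex.Re (G t))%:E))%E).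
    exact: integrableD.
  by apply/funext => t; rewrite -EFinD; congr EFin; case: (F t); case: (G t).
- rewrite (_ : (fun t => _) =
    ((fun t => (complex.Im (F t))%:E) \+ (fun t => (complex.Im (G t))%:E))%E).
    exact: integrableD.
  by apply/funext => t; rewrite -EFinD; congr EFin; case: (F t); case: (G t).
Qed.

Lemma cintegralD F G : cintegrable F -> cintegrable G ->
  cintegral (fun t => F t + G t) = cintegral F + cintegral G.
Proof.
move=> [Fr Fi] [Gr Gi]; rewrite /cintegral; apply/eqP; rewrite eq_complex /=.
apply/andP; split; apply/eqP; rewrite -RintegralD//; apply: eq_Rintegral => t _;
  by case: (F t); case: (G t).
Qed.

Lemma cintegralZ c F : cintegrable F ->
  cintegral (fun t => c * F t) = c * cintegral F.
Proof.
move=> [Fr Fi]; case: c => a b; rewrite /cintegral; apply/eqP.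
rewrite eq_complex /=; apply/andP; split; apply/eqP.
- rewrite -!RintegralZl// -RintegralB//; first last.
  + exact: (integrableZl mD b Fi).
  + exact: (integrableZl mD a Fr).
  by apply: eq_Rintegral => t _; case: (F t).
- rewrite -!RintegralZl// -RintegralD//; first last.
  + exact: (integrableZl mD b Fr).
  + exact: (integrableZl mD a Fi).
  by apply: eq_Rintegral => t _; case: (F t).
Qed.

Lemma cintegrableB F G : cintegrable F -> cintegrable G ->
  cintegrable (fun t => F t - G t).
Proof.
move=> iF iG; have -> : (fun t => F t - G t) = (fun t => F t + (-1) * G t).
  by apply/funext => t; rewrite mulN1r.
by apply: cintegrableD => //; exact: cintegrableZ.
Qed.

Lemma cintegralB F G : cintegrable F -> cintegrable G ->
  cintegral (fun t => F t - G t) = cintegral F - cintegral G.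
Proof.
move=> iF iG; rewrite -[- cintegral G]mulN1r -cintegralZ// -cintegralD//.
  by congr cintegral; apply/funext => t; rewrite mulN1r.
exact: cintegrableZ.
Qed.

(** With [z] the integral, [|z|^2] is the real part of the integral of
    [conj z * F], which is at most [|z|] times the integral of [|F|]. *)
Lemma modulus_cintegral_le F (g : T -> R) : cintegrable F ->
  (forall t, D t -> modulus (F t) <= g t) ->
  mu.-integrable D (EFin \o g) ->
  modulus (cintegral F) <= \int[mu]_(t in D) g t.
Proof.
move=> iF Fg ig; have I0 : 0 <= \int[mu]_(t in D) g t.
  by apply: Rintegral_ge0 => t /Fg; apply: le_trans; exact: modulus_ge0.
have [->|z0] := eqVneq (cintegral F) 0; first by rewrite modulus0.
set z := cintegral F in z0 *.
have m0 : 0 < modulus z by rewrite modulus_gt0.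
rewrite -(ler_pM2l m0) -expr2.
have -> : modulus z ^+ 2 = complex.Re (z^*%C * z).
  by rewrite modulus_sqr; case: (z) => a b /=; ring.
have [iR _] := cintegrableZ (z^*%C) iF.
rewrite -cintegralZ// /= -RintegralZl//; apply: le_Rintegral => //.
  exact: (integrableZl mD (modulus z) ig).
move=> t Dt; have := Re_le_modulus (z^*%C * F t).
have -> : modulus (z^*%C * F t) = modulus z * modulus (F t).
  by rewrite modulusM modulus_conj.
have := Fg _ Dt; have := modulus_ge0 (F t).
move: (complex.Re (z^*%C * F t)) => x m1 m2; rewrite ler_norml => /andP[_ H].
by rewrite (le_trans H)// ler_wpM2l// ltW.
Qed.

End ComplexIntegral.

Section IntervalIntegral.
Context {R : realType}.
Local Notation C := (R[i])%C.
Local Notation mu := (@lebesgue_measure R).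
Implicit Types (u v : R -> R) (F : R -> C) (a b c M : R).

Lemma integrable_itv u a b : {in `[a, b], continuous u} ->
  mu.-integrable `[a, b] (EFin \o u).
Proof.
move=> cu; apply: continuous_compact_integrable; first exact: segment_compact.
by apply: continuous_in_subspaceT => x; rewrite inE => /cu.
Qed.

Lemma cintegrable_itv F a b : {in `[a, b], forall t, curve_cont F t} ->
  cintegrable mu `[a, b] F.
Proof.
move=> cF; split; apply: integrable_itv => x /cF.
  exact: curve_cont_Re.
exact: curve_cont_Im.
Qed.

Lemma Rintegral_itv_cst c a b : a <= b -> \int[mu]_(x in `[a, b]) c = c * (b - a).
Proof.
move=> ab; rewrite Rintegral_cst//= lebesgue_measure_itv/= lte_fin.
by case: ltgtP ab => // -> _; rewrite subrr.
Qed.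

Lemma Rintegral_itv_split u a c b : {in `[a, b], continuous u} ->
  a <= c -> c <= b ->
  \int[mu]_(x in `[a, b]) u x =
    \int[mu]_(x in `[a, c]) u x + \int[mu]_(x in `[c, b]) u x.
Proof.
move=> cu ac cb; have iu := integrable_itv cu.
have := @Rintegral_itvB _ u (BLeft a) (BRight b) c iu.
rewrite !bnd_simp => /(_ ac cb) H; apply/eqP; rewrite addrC -subr_eq H.
rewrite Rintegral_itv_obnd_cbnd//.
apply: integrableS iu => //; apply: subset_itvr; by rewrite bnd_simp.
Qed.

Lemma Rintegral_itv_bound u a b c M : a <= b -> {in `[a, b], continuous u} ->
  {in `[a, b], forall x, `|u x - c| <= M} ->
  `|\int[mu]_(x in `[a, b]) u x - c * (b - a)| <= M * (b - a).
Proof.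
move=> ab cu uM; rewrite -Rintegral_itv_cst//.
have ic : mu.-integrable `[a, b] (EFin \o (fun=> c)).
  by apply: integrable_itv => x _; exact: cst_continuous.
have icM : mu.-integrable `[a, b] (EFin \o (fun=> M)).
  by apply: integrable_itv => x _; exact: cst_continuous.
have iu := integrable_itv cu.
rewrite -RintegralB// (le_trans (le_normr_Rintegral _ _))//.
  exact: (integrableB _ iu ic).
rewrite -Rintegral_itv_cst//; apply: le_Rintegral => //.
apply: integrable_itv => x xab; apply: cvg_norm.
by apply: cvgB; [exact: cu|exact: cvg_cst].
Qed.

End IntervalIntegral.

(** * Goursat's theorem on rectangles *)

Section Goursat.
Context {R : realType}.
Local Notation C := (R[i])%C.
Local Notation mu := (@lebesgue_measure R).
Implicit Types (a b c d x y h k e : R).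

Lemma nested_intervals (l r : nat -> R) :
  (forall n, l n <= l n.+1) -> (forall n, r n.+1 <= r n) ->
  (forall n, l n <= r n) -> exists x, forall n, l n <= x <= r n.
Proof.
move=> lS rS lr.
have lm m n : (m <= n)%N -> l m <= l n.
  elim: n => [|n IH]; first by rewrite leqn0 => /eqP ->.
  by rewrite leq_eqVlt => /predU1P[->//|/IH mn]; exact: le_trans mn (lS n).
have rm m n : (m <= n)%N -> r n <= r m.
  elim: n => [|n IH]; first by rewrite leqn0 => /eqP ->.
  by rewrite leq_eqVlt => /predU1P[->//|/IH mn]; exact: le_trans (rS n) mn.
have lrmn m n : l m <= r n.
  have := lm _ _ (leq_maxl m n); have := rm _ _ (leq_maxr m n).
  by have := lr (maxn m n); lra.
exists (sup (range l)) => n; apply/andP; split.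
  apply: ub_le_sup; last by exists n.
  by exists (r 0%N) => _ [m _ <-].
by apply: ge_sup; [exists (l 0%N), 0%N|move=> _ [m _ <-]].
Qed.

Variable G : C -> C.

Definition im_horizontal y a b := \int[mu]_(x in `[a, b]) complex.Im (G (x +i* y)%C).
Definition re_vertical x c d := \int[mu]_(y in `[c, d]) complex.Re (G (x +i* y)%C).

(** The imaginary part of the integral of [G] along the boundary of the
    rectangle [[a, b] x [c, d]]. *)
Definition im_contour a b c d :=
  im_horizontal c a b - im_horizontal d a b + (re_vertical b c d - re_vertical a c d).

Definition cdiff_on a b c d := forall x y, a <= x <= b -> c <= y <= d ->
  exists D, cdiff G (x +i* y)%C D.

Lemma cdiff_on_curve a b c d x y : cdiff_on a b c d -> a <= x <= b -> c <= y <= d ->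
  curve_cont (fun s => G (s +i* y)%C) x /\ curve_cont (fun s => G (x +i* s)%C) y.
Proof.
move=> hG xab ycd; have [D /cdiff_ccont GD] := hG _ _ xab ycd.
split.
- have -> : (fun s => G (s +i* y)%C) = G \o (fun s => (0 +i* y)%C + s%:C%C * 1).
    apply/funext => s /=; congr G; apply/eqP; rewrite eq_complex /=.
    by rewrite !(mulr1, mulr0, mul0r, addr0, subr0, add0r) !eqxx.
  apply: curve_cont_comp; last exact: curve_cont_line.
  have -> : (0 +i* y)%C + x%:C%C * 1 = (x +i* y)%C; last by [].
  by apply/eqP; rewrite eq_complex /= !(mulr1, mulr0, mul0r, addr0, subr0, add0r) !eqxx.
- have -> : (fun s => G (x +i* s)%C) = G \o (fun s => (x +i* 0)%C + s%:C%C * 'i%C).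
    apply/funext => s /=; congr G; apply/eqP; rewrite eq_complex /=.
    by rewrite !(mulr1, mulr0, mul0r, addr0, subr0, add0r) !eqxx.
  apply: curve_cont_comp; last exact: curve_cont_line.
  have -> : (x +i* 0)%C + y%:C%C * 'i%C = (x +i* y)%C; last by [].
  by apply/eqP; rewrite eq_complex /= !(mulr1, mulr0, mul0r, addr0, subr0, add0r) !eqxx.
Qed.

Lemma cdiff_on_im_continuous a b c d y : cdiff_on a b c d -> c <= y <= d ->
  {in `[a, b], continuous (fun x => complex.Im (G (x +i* y)%C))}.
Proof.
move=> hG ycd x; rewrite in_itv /= => xab; apply: curve_cont_Im.
by case: (cdiff_on_curve hG xab ycd).
Qed.

Lemma cdiff_on_re_continuous a b c d x : cdiff_on a b c d -> a <= x <= b ->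
  {in `[c, d], continuous (fun y => complex.Re (G (x +i* y)%C))}.
Proof.
move=> hG xab y; rewrite in_itv /= => ycd; apply: curve_cont_Re.
by case: (cdiff_on_curve hG xab ycd).
Qed.

Lemma cdiff_onS a b c d a' b' c' d' : cdiff_on a b c d ->
  a <= a' -> b' <= b -> c <= c' -> d' <= d -> cdiff_on a' b' c' d'.
Proof.
by move=> hG aa bb cc dd x y /andP[? ?] /andP[? ?]; apply: hG; apply/andP; split; lra.
Qed.

Lemma im_contour_split4 a m b c n d : cdiff_on a b c d ->
  a <= m <= b -> c <= n <= d ->
  im_contour a b c d = im_contour a m c n + im_contour m b c n
                     + (im_contour a m n d + im_contour m b n d).
Proof.
move=> hG /andP[am mb] /andP[cn nd]; rewrite /im_contour.
have sH y : c <= y <= d -> im_horizontal y a b = im_horizontal y a m + im_horizontal y m b.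
  by move=> ycd; apply: Rintegral_itv_split => //; exact: cdiff_on_im_continuous hG ycd.
have sV x : a <= x <= b -> re_vertical x c d = re_vertical x c n + re_vertical x n d.
  by move=> xab; apply: Rintegral_itv_split => //; exact: cdiff_on_re_continuous hG xab.
rewrite (sH c) ?lexx ?(le_trans cn)// (sH d) ?lexx ?(le_trans cn)//.
rewrite (sV a) ?lexx ?(le_trans am)// (sV b) ?lexx ?(le_trans am)//.
ring.
Qed.

(** The affine part of [G] at [(X, Y)] contributes nothing, by the
    Cauchy-Riemann equations; the remainder is bounded by [e] times the size of
    the rectangle and is integrated over a contour of comparable length. *)
Lemma im_contour_small a b c d X Y D e r : cdiff_on a b c d ->
  a <= X <= b -> c <= Y <= d -> (b - a) + (d - c) < r -> 0 < e ->
  (forall k : C, modulus k < r ->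
    modulus (G ((X +i* Y)%C + k) - G (X +i* Y)%C - D * k) <= e * modulus k) ->
  `|im_contour a b c d| <= 2 * e * ((b - a) + (d - c)) ^+ 2.
Proof.
move=> hG /andP[aX Xb] /andP[cY Yd] sr e0 GD; set S := (b - a) + (d - c).
have ab : a <= b by lra.
have cd : c <= d by lra.
have near x y : a <= x <= b -> c <= y <= d ->
    modulus (G (x +i* y)%C - G (X +i* Y)%C - D * ((x - X) +i* (y - Y))%C) <= e * S.
  move=> /andP[ax xb] /andP[cy yd].
  have kS : modulus ((x - X) +i* (y - Y))%C <= S.
    apply: le_trans (modulus_le_ReIm _) _ => /=.
    have : `|x - X| <= b - a by rewrite ler_norml; apply/andP; split; lra.
    have : `|y - Y| <= d - c by rewrite ler_norml; apply/andP; split; lra.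
    by rewrite /S; lra.
  have := GD _ (le_lt_trans kS sr).
  have -> : (X +i* Y)%C + ((x - X) +i* (y - Y))%C = (x +i* y)%C.
    by apply/eqP; rewrite eq_complex /= !subrKC !eqxx.
  by move=> /le_trans; apply; rewrite ler_pM2l.
have imB : `|(im_horizontal c a b - im_horizontal d a b) - complex.Re D * (c - d) * (b - a)|
    <= 2 * e * S * (b - a).
  have cc : c <= c <= d by rewrite lexx.
  have dd : c <= d <= d by rewrite lexx cd.
  rewrite /im_horizontal -RintegralB//; first last.
    by apply: integrable_itv; exact: cdiff_on_im_continuous hG dd.
    by apply: integrable_itv; exact: cdiff_on_im_continuous hG cc.
  apply: Rintegral_itv_bound => // [x xab|x].
    by apply: cvgB; apply: cdiff_on_im_continuous xab; [exact: hG| |exact: hG|].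
  rewrite in_itv /= => xab.
  have := le_trans (Im_le_modulus _) (near _ _ xab cc).
  have := le_trans (Im_le_modulus _) (near _ _ xab dd).
  case: (D) (G (X +i* Y)%C) (G (x +i* c)%C) (G (x +i* d)%C) => D1 D2 [p1 p2] [q1 q2] [s1 s2] /=.
  rewrite !ler_norml => /andP[? ?] /andP[? ?]; apply/andP; split; lra.
have reB : `|(re_vertical b c d - re_vertical a c d) - complex.Re D * (b - a) * (d - c)|
    <= 2 * e * S * (d - c).
  have aa : a <= a <= b by rewrite lexx.
  have bb : a <= b <= b by rewrite lexx ab.
  rewrite /re_vertical -RintegralB//; first last.
    by apply: integrable_itv; exact: cdiff_on_re_continuous hG aa.
    by apply: integrable_itv; exact: cdiff_on_re_continuous hG bb.
  apply: Rintegral_itv_bound => // [y ycd|y].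
    by apply: cvgB; apply: cdiff_on_re_continuous ycd; [exact: hG| |exact: hG|].
  rewrite in_itv /= => ycd.
  have := le_trans (Re_le_modulus _) (near _ _ aa ycd).
  have := le_trans (Re_le_modulus _) (near _ _ bb ycd).
  case: (D) (G (X +i* Y)%C) (G (a +i* y)%C) (G (b +i* y)%C) => D1 D2 [p1 p2] [q1 q2] [s1 s2] /=.
  rewrite !ler_norml => /andP[? ?] /andP[? ?]; apply/andP; split; lra.
rewrite /im_contour.
move: imB reB; set I1 := im_horizontal c a b - _; set I2 := re_vertical b c d - _.
have -> : 2 * e * S ^+ 2 = 2 * e * S * (b - a) + 2 * e * S * (d - c).
  by rewrite /S; ring.
have -> : complex.Re D * (c - d) * (b - a) = - (complex.Re D * (b - a) * (d - c)) by ring.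
move: (complex.Re D * _ * _) => Z.
rewrite !ler_norml => /andP[? ?] /andP[? ?]; apply/andP; split; lra.
Qed.

(** One of the four quarters of a rectangle carries at least a quarter of the
    contour integral. Iterating the choice gives nested rectangles shrinking to
    a point, where [im_contour_small] bounds the integral by an arbitrarily
    small multiple of the area scale [4^-n]. The derivative of [G] is not
    assumed continuous, so differentiation under the integral sign would not
    do. *)
Theorem goursat_rectangle a b c d : a <= b -> c <= d -> cdiff_on a b c d ->
  im_contour a b c d = 0.
Proof.
move=> ab cd hG.
have [h hE] : exists h : nat -> R, forall n, h n = (b - a) / 2 ^+ n by eexists.
have [k kE] : exists k : nat -> R, forall n, k n = (d - c) / 2 ^+ n by eexists.
pose cell n (p : R * R) := im_contour p.1 (p.1 + h n) p.2 (p.2 + k n).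
pose inside n (p : R * R) :=
  [/\ a <= p.1, p.1 + h n <= b, c <= p.2 & p.2 + k n <= d].
have h0 n : 0 <= h n by rewrite hE divr_ge0 ?subr_ge0 ?exprn_ge0.
have k0 n : 0 <= k n by rewrite kE divr_ge0 ?subr_ge0 ?exprn_ge0.
have hS n : h n = h n.+1 + h n.+1.
  by rewrite !hE exprS invfM; field; rewrite expf_neq0.
have kS n : k n = k n.+1 + k n.+1.
  by rewrite !kE exprS invfM; field; rewrite expf_neq0.
have [nxt nxtP] : {nxt : nat * (R * R) -> R * R &
    forall np : nat * (R * R), inside np.1 np.2 ->
    [/\ inside np.1.+1 (nxt np),
        np.2.1 <= (nxt np).1 <= np.2.1 + h np.1.+1,
        np.2.2 <= (nxt np).2 <= np.2.2 + k np.1.+1 &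
        `|cell np.1 np.2| <= 4 * `|cell np.1.+1 (nxt np)|]}.
  pose good (np : nat * (R * R)) (p : R * R) := inside np.1 np.2 ->
    [/\ inside np.1.+1 p, np.2.1 <= p.1 <= np.2.1 + h np.1.+1,
        np.2.2 <= p.2 <= np.2.2 + k np.1.+1 &
        `|cell np.1 np.2| <= 4 * `|cell np.1.+1 p|].
  apply: (@choice _ _ good) => -[n [x y]]; have [|nin] := pselect (inside n (x, y)); last by exists (x, y).
  rewrite /inside /cell /=; rewrite (hS n) (kS n) => -[ax xb cy yd].
  have h1 := h0 n.+1; have k1 := k0 n.+1.
  have hG' : cdiff_on x (x + h n) y (y + k n).
    by apply: cdiff_onS hG _ _ _ _; rewrite ?(hS n) ?(kS n).
  rewrite /good /cell /inside /= (hS n) (kS n) (addrA x) (addrA y); set m := x + h n.+1; set p := y + k n.+1.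
  have := @im_contour_split4 _ m _ _ p _ hG'.
  rewrite (hS n) (kS n) (addrA x) (addrA y) -/m -/p => /(_ ltac:(by rewrite /m; apply/andP; split; lra) ltac:(by rewrite /p; apply/andP; split; lra)).
  set B := im_contour x _ y _ => BE.
  suff : [\/ `|B| <= 4 * `|im_contour x m y p|,
             `|B| <= 4 * `|im_contour m (m + h n.+1) y p|,
             `|B| <= 4 * `|im_contour x m p (p + k n.+1)| |
             `|B| <= 4 * `|im_contour m (m + h n.+1) p (p + k n.+1)|].
    case=> HB; [exists (x, y)|exists (m, y)|exists (x, p)|exists (m, p)]; move=> _ /=;
      split => //; rewrite /inside /m /p /=; try split; lra.
  have T : `|B| <= `|im_contour x m y p| + `|im_contour m (m + h n.+1) y p| +
     (`|im_contour x m p (p + k n.+1)| + `|im_contour m (m + h n.+1) p (p + k n.+1)|).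
    by rewrite BE (le_trans (ler_normD _ _))// lerD ?ler_normD.
  have [|H1] := leP `|B| (4 * `|im_contour x m y p|); first by constructor 1.
  have [|H2] := leP `|B| (4 * `|im_contour m (m + h n.+1) y p|); first by constructor 2.
  have [|H3] := leP `|B| (4 * `|im_contour x m p (p + k n.+1)|); first by constructor 3.
  constructor 4; lra.
pose P := fix P n := if n is n'.+1 then nxt (n', P n') else (a, c).
have Pin n : inside n (P n).
  elim: n => [|n IH] /=; last by case: (nxtP (n, P n) IH).
  by rewrite /inside /= hE kE !expr0 !divr1 !subrKC.
have Pcell n : `|im_contour a b c d| <= 4 ^+ n * `|cell n (P n)|.
  elim: n => [|n IH].
    by rewrite expr0 mul1r /cell /= hE kE !expr0 !divr1 !subrKC.
  rewrite (le_trans IH)// exprSr -mulrA ler_wpM2l ?exprn_ge0//.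
  by case: (nxtP (n, P n) (Pin n)).
have [X XP] : exists X, forall n, (P n).1 <= X <= (P n).1 + h n.
  apply: nested_intervals => n.
  - by case: (nxtP (n, P n) (Pin n)) => _ /andP[].
  - by case: (nxtP (n, P n) (Pin n)) => _ /andP[_ /=]; rewrite (hS n); lra.
  - by rewrite lerDl.
have [Y YP] : exists Y, forall n, (P n).2 <= Y <= (P n).2 + k n.
  apply: nested_intervals => n.
  - by case: (nxtP (n, P n) (Pin n)) => _ _ /andP[].
  - by case: (nxtP (n, P n) (Pin n)) => _ _ /andP[_ /=]; rewrite (kS n); lra.
  - by rewrite lerDl.
have Xab : a <= X <= b by have := XP 0%N; have [] := Pin 0%N; lra.
have Ycd : c <= Y <= d by have := YP 0%N; have [] := Pin 0%N; lra.
have [D GD] := hG _ _ Xab Ycd.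
set S := (b - a) + (d - c); have S0 : 0 <= S by rewrite /S; lra.
suff small e : 0 < e -> `|im_contour a b c d| <= 2 * e * S ^+ 2.
  apply/eqP; rewrite -normr_le0; apply/ler_addgt0Pl => e e0; rewrite addr0.
  have D1 : 0 < 2 * (S ^+ 2 + 1) by rewrite mulr_gt0// ltr_wpDl ?sqr_ge0.
  apply: le_trans (small (e / (2 * (S ^+ 2 + 1))) _) _; first exact: divr_gt0.
  have D2 : 0 < S ^+ 2 + 1 by rewrite ltr_wpDl ?sqr_ge0.
  have -> : 2 * (e / (2 * (S ^+ 2 + 1))) * S ^+ 2 = e * (S ^+ 2 / (S ^+ 2 + 1)).
    by field; rewrite gt_eqF.
  by rewrite ler_piMr ?(ltW e0)// ler_pdivrMr// mul1r lerDl.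
move=> e0; have [r r0 Gr] := GD _ e0.
have [n nP] : exists n, S / 2 ^+ n < r.
  exists (Num.Def.archi_bound (S / r)).
  rewrite ltr_pdivrMr ?exprn_gt0// mulrC -ltr_pdivrMr//.
  apply: lt_le_trans (archi_boundP (divr_ge0 S0 (ltW r0))) _.
  by rewrite -natrX ler_nat ltnW// ltn_expl.
have hk : (P n).1 + h n - (P n).1 + ((P n).2 + k n - (P n).2) = S / 2 ^+ n.
  by rewrite hE kE /S; ring.
apply: le_trans (Pcell n) _.
have : `|cell n (P n)| <= 2 * e * (S / 2 ^+ n) ^+ 2.
  rewrite -hk; apply: (im_contour_small (X := X) (Y := Y) (D := D) (r := r)) => //; last by rewrite hk.
  have [? ? ? ?] := Pin n; exact: cdiff_onS hG _ _ _ _.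
move=> H; apply: le_trans (ler_wpM2l _ H) _; first by rewrite exprn_ge0.
have -> : (4 : R) ^+ n = 2 ^+ n * 2 ^+ n by rewrite -exprMn; congr (_ ^+ _); ring.
rewrite le_eqVlt; apply/orP; left; apply/eqP; field.
by rewrite expf_neq0.
Qed.

End Goursat.

(** * The mean value property and its consequences *)

Section CircleMean.
Context {R : realType}.
Local Notation C := (R[i])%C.
Local Notation mu := (@lebesgue_measure R).
Local Notation circle := `[0%R, (2 * pi)%R]%classic.
Implicit Types (f F : C -> C) (z w k c : C).

Let pi2_ge0 : 0 <= 2 * pi :> R.
Proof. by rewrite mulr_ge0 ?pi_ge0. Qed.

Let pi2_gt0 : 0 < 2 * pi :> R.
Proof. by rewrite mulr_gt0 ?pi_gt0. Qed.

Lemma eq_of_dist_le_scaled (x y K : R) : 0 < K ->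
  (forall e : R, 0 < e -> `|x - y| <= e * K) -> x = y.
Proof.
move=> K0 H; apply/eqP; rewrite -subr_eq0 -normr_le0; apply/ler_addgt0Pl => e e0.
by rewrite addr0 (le_trans (H (e / K) _)) ?divr_gt0// divfK// gt_eqF.
Qed.

(** Goursat's theorem for [F \o cexp] on [[s, 0] x [0, 2 pi]]: the horizontal
    sides cancel by periodicity, so the mean of [F] over the circle of radius
    [expR s] does not depend on [s]; it tends to [L] as [s] tends to [-oo]. *)
Lemma Re_circle_mean_value F L :
  (forall z, 0 < modulus z <= 1 -> exists d, cdiff F z d) ->
  (forall e : R, 0 < e -> exists2 a : R, 0 < a &
    forall k, 0 < modulus k < a -> modulus (F k - L) < e) ->
  \int[mu]_(t in circle) complex.Re (F (polar 1 t)) = complex.Re L * (2 * pi).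
Proof.
move=> dF FL; apply: (@eq_of_dist_le_scaled _ _ (2 * pi)) => // e e0.
have [a a0 aP] := FL _ e0.
pose s : R := Num.min 0 (ln (a / 2)).
have s0 : s <= 0 by rewrite ge_min lexx.
have sa : expR s < a.
  apply: (@le_lt_trans _ _ (a / 2)); last lra.
  rewrite -[leRHS]lnK ?posrE ?divr_gt0// ler_expR ge_min lexx orbT//.
pose G := F \o cexp.
have hG : cdiff_on G s 0 0 (2 * pi).
  move=> x y /andP[_ x0] _; have [|d Fd] := dF (cexp (x +i* y)%C).
    by rewrite modulus_cexp expR_gt0 /= -expR0 ler_expR.
  by exists (d * cexp (x +i* y)%C); apply: cdiff_comp => //; exact: cdiff_cexp.
have := goursat_rectangle s0 pi2_ge0 hG; rewrite /im_contour.
have -> : im_horizontal G (2 * pi) s 0 = im_horizontal G 0 s 0.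
  apply: eq_Rintegral => x _; rewrite /G /= /cexp /= /polar.
  have := cosD2pi (0 : R); have := sinD2pi (0 : R).
  by rewrite add0r mulr2n mulrDl !mul1r => -> ->.
rewrite subrr add0r => /eqP; rewrite subr_eq0 => /eqP.
have -> : re_vertical G 0 0 (2 * pi) = \int[mu]_(t in circle) complex.Re (F (polar 1 t)).
  by apply: eq_Rintegral => y _; rewrite /G /= -polar1E.
move=> ->; have cG : {in `[0, 2 * pi], continuous (fun y => complex.Re (G (s +i* y)%C))}.
  by apply: cdiff_on_re_continuous hG _; rewrite lexx s0.
have := @Rintegral_itv_bound _ _ _ _ (complex.Re L) e pi2_ge0 cG.
rewrite subr0; apply=> y _; have := Re_le_modulus (G (s +i* y)%C - L).
rewrite raddfB /= => /le_trans; apply; apply/ltW/aP.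
by rewrite modulus_cexp expR_gt0.
Qed.

(** The value at the centre is given as a limit [L] so that [F] may be a
    difference quotient, with [L] the derivative. *)
Theorem circle_mean_value F L :
  (forall z, 0 < modulus z <= 1 -> exists d, cdiff F z d) ->
  (forall e : R, 0 < e -> exists2 a : R, 0 < a &
    forall k, 0 < modulus k < a -> modulus (F k - L) < e) ->
  cintegral mu circle (fun t => F (polar 1 t)) = (2 * pi)%:C%C * L.
Proof.
move=> dF FL; rewrite /cintegral (Re_circle_mean_value dF FL).
have ImE z : complex.Im z = complex.Re (- 'i%C * z).
  by case: z => x y /=; ring.
have -> : \int[mu]_(t in circle) complex.Im (F (polar 1 t)) =
   complex.Re (- 'i%C * L) * (2 * pi).
  under eq_Rintegral do rewrite ImE.
  apply: (@Re_circle_mean_value (fun z => - 'i%C * F z)).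
  - by move=> z /dF[d Fd]; exists (- 'i%C * d); exact: cdiffZ.
  - move=> e /FL[a a0 aP]; exists a => // k /aP; rewrite -mulrBr modulusM modulusN.
    by rewrite /(modulus 'i%C) /= expr0n expr1n add0r sqrtr1 mul1r.
rewrite -ImE; case: L {FL} => x y; apply/eqP; rewrite eq_complex /=.
by apply/andP; split; apply/eqP; ring.
Qed.

(** The automorphism of the unit disc that sends 0 to [k]. *)
Definition moebius (k : R) z : C := (z + k%:C%C) / (1 + k%:C%C * z).

Lemma moebius_den (k : R) z : 0 <= k < 1 -> modulus z <= 1 -> 1 + k%:C%C * z != 0.
Proof.
move=> /andP[k0 k1] z1; rewrite -modulus_gt0.
have := modulus_le_dist 1 (1 + k%:C%C * z).
rewrite opprD addNKr modulusN modulus1 modulusM modulus_nneg//.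
by have := ler_piMr k0 z1; lra.
Qed.

Lemma cdiff_moebius (k : R) z : 0 <= k < 1 -> modulus z <= 1 ->
  exists d, cdiff (moebius k) z d.
Proof.
move=> kk z1; eexists; apply: cdiffM.
  by apply: cdiffD; [exact: cdiff_id|exact: cdiff_cst].
apply: (@cdiff_comp _ (fun w => 1 + k%:C%C * w) (fun w => w^-1)).
  exact: cdiffD (cdiff_cst 1 z) (cdiffZ _ (cdiff_id z)).
by apply: cdiff_inv; exact: moebius_den.
Qed.

Lemma modulus_moebius (k : R) z : 0 <= k < 1 -> modulus z = 1 ->
  modulus (moebius k z) = 1.
Proof.
move=> kk z1; have D : 1 + k%:C%C * z != 0 by apply: moebius_den; rewrite ?z1.
rewrite /moebius modulusM modulusV.
(* On the unit circle the denominator is [z] times the conjugate of the numerator. *)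
have -> : modulus (z + k%:C%C) = modulus (1 + k%:C%C * z).
  have E : z * conjc z = 1.
    have := sqr_normc z; rewrite normC_modulus z1 => <-.
    by rewrite expr1n.
  have -> : 1 + k%:C%C * z = z * conjc (z + k%:C%C).
    by rewrite raddfD /= mulrDr E oppr0 mulrC.
  rewrite modulusM z1 mul1r /modulus; case: (z + _) => a b /=.
  by rewrite sqrrN.
by rewrite divff// gt_eqF// modulus_gt0.
Qed.

(** [moebius k] is differentiable on the closed disc and preserves the unit
    circle, so the mean value property applies to its composition with [f] and
    evaluates [f] off the centre. *)
Lemma moebius_mean_value f c (k : R) : entire f -> 0 <= k < 1 ->
  cintegral mu circle (fun t => f (c * moebius k (polar 1 t))) =
    (2 * pi)%:C%C * f (c * k%:C%C).
Proof.
move=> /entireP ef kk.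
have dF z : modulus z <= 1 -> exists d, cdiff (fun z => f (c * moebius k z)) z d.
  move=> z1; have [d md] := cdiff_moebius kk z1.
  have [d' fd] := ef (c * moebius k z).
  exists (d' * (c * d)); apply: (@cdiff_comp _ (fun z => c * moebius k z) f) => //.
  exact: cdiffZ.
apply: (@circle_mean_value (fun z => f (c * moebius k z))).
  by move=> z /andP[_]; exact: dF.
have [|d /cdiff_ccont F0] := dF 0; first by rewrite modulus0.
move=> e /F0[a a0 aP]; exists a => // w /andP[_ /aP].
rewrite add0r; have -> : moebius k 0 = k%:C%C by rewrite /moebius add0r mulr0 addr0 divr1.
by [].
Qed.

Lemma curve_cont_moebius f c (k : R) t : entire f -> 0 <= k < 1 ->
  curve_cont (fun t => f (c * moebius k (polar 1 t))) t.
Proof.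
move=> /entireP ef kk; have [d fd] := ef (c * moebius k (polar 1 t)).
apply: (@curve_cont_comp _ f (fun t => c * moebius k (polar 1 t))); first exact: cdiff_ccont fd.
apply: (@curve_cont_comp _ ( *%R c)); first exact: ccontMl.
have [|d' md] := @cdiff_moebius k (polar 1 t) kk; first by rewrite modulus_polar.
by apply: (@curve_cont_comp _ (moebius k)); [exact: cdiff_ccont md|exact: curve_cont_polar1].
Qed.

Lemma entire_curve f (F : R -> C) t : entire f -> curve_cont F t -> curve_cont (f \o F) t.
Proof.
move=> /entireP ef cF; have [d /cdiff_ccont fd] := ef (F t).
exact: curve_cont_comp.
Qed.

Lemma cintegral_circle_bound (M : R) (u : R -> C) : {in circle, forall t, curve_cont u t} ->
  (forall t, circle t -> modulus (u t) <= M) ->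
  modulus (cintegral mu circle u) <= M * (2 * pi).
Proof.
move=> cu uM; have := @Rintegral_itv_cst _ M 0 (2 * pi) pi2_ge0.
rewrite subr0 => <-.
apply: modulus_cintegral_le => //.
  by apply: cintegrable_itv => t tC; apply: cu; rewrite inE.
by apply: integrable_itv => x _; exact: cst_continuous.
Qed.

(** By rotating the disc, automorphisms with a real parameter suffice to reach
    every point. *)
Lemma disc_decomp (r : R) z : modulus z < r -> exists c, exists2 k : R,
  0 <= k < 1 & modulus c = r /\ z = c * k%:C%C.
Proof.
move=> zr; have r0 : 0 < r := le_lt_trans (modulus_ge0 z) zr.
have [t _ zE] := polar_surj z.
exists (polar r t); exists (modulus z / r).
  by rewrite divr_ge0 ?modulus_ge0 ?(ltW r0)//= ltr_pdivrMr// mul1r.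
split; first by rewrite modulus_polar// ltW.
rewrite [LHS]zE -polar_at0 polarM addr0; congr polar.
by rewrite mulrCA divff ?mulr1// gt_eqF.
Qed.

(** The value at an interior point is a mean of values on the circle, by
    [moebius_mean_value]. *)
Lemma maximum_principle f (r M : R) z : entire f ->
  (forall w, modulus w = r -> modulus (f w) <= M) ->
  modulus z <= r -> modulus (f z) <= M.
Proof.
move=> ef fM; rewrite le_eqVlt => /predU1P[/fM//|zr].
have [c [k kk [cr ->]]] := disc_decomp zr.
rewrite -(ler_pM2r pi2_gt0).
have -> : modulus (f (c * k%:C%C)) * (2 * pi) = modulus ((2 * pi)%:C%C * f (c * k%:C%C)).
  by rewrite modulusM modulus_nneg// mulrC.
rewrite -moebius_mean_value//; apply: cintegral_circle_bound => //.
  by move=> t _; exact: curve_cont_moebius.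
by move=> t _; apply: fM; rewrite modulusM modulus_moebius ?mulr1// modulus_polar.
Qed.

(** The maximum principle reduces the bound on the disc to the compactness of
    the interval that parametrizes its boundary. *)
Lemma entire_bounded_disc f (r : R) : entire f -> exists2 M : R, 0 <= M &
  forall z, modulus z <= r -> modulus (f z) <= M.
Proof.
move=> ef; have [r0|r0] := ltP r 0.
  exists 0 => // z zr; have := modulus_ge0 z; lra.
have [||t0 _ tM] := @EVT_max R (fun t => modulus (f (polar r t))) 0 (2 * pi) => //.
  apply: continuous_in_subspaceT => t _; apply: (@curve_cont_modulus _ (f \o polar r)).
  by apply: entire_curve => //; exact: curve_cont_polar.
exists (modulus (f (polar r t0))); first exact: modulus_ge0.
move=> z; apply: maximum_principle => // w wr.
by have [t tI ->] := polar_surj w; rewrite wr; apply: tM; rewrite in_itv.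
Qed.

(** Cauchy's estimate: the derivative is the mean over the unit circle of the
    difference quotient, which extends continuously to the centre. *)
Lemma cauchy_estimate f z d (M : R) : entire f -> cdiff f z d ->
  (forall w, modulus w = 1 -> modulus (f (z + w) - f z) <= M) -> modulus d <= M.
Proof.
move=> ef fd fM; pose q w := (f (w + z) - f z) * w^-1.
have dq w : w != 0 -> exists d', cdiff q w d'.
  move=> w0; have [d' fd'] := (entireP f).1 ef (w + z).
  eexists; apply: cdiffM; last exact: cdiff_inv.
  by apply: cdiffB; [exact: cdiff_shift fd'|exact: cdiff_cst].
rewrite -(ler_pM2r pi2_gt0).
have -> : modulus d * (2 * pi) = modulus ((2 * pi)%:C%C * d).
  by rewrite modulusM modulus_nneg// mulrC.
rewrite -(@circle_mean_value q).
- apply: cintegral_circle_bound => t _.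
    have [|d' qd] := dq (polar 1 t); first by rewrite -modulus_gt0 modulus_polar.
    by apply: (@curve_cont_comp _ q); [exact: cdiff_ccont qd|exact: curve_cont_polar1].
  by rewrite modulusM modulusV modulus_polar// invr1 mulr1 (addrC _ z) fM// modulus_polar.
- by move=> w /andP[w0 _]; apply: dq; rewrite -modulus_gt0.
- move=> e e0; have [a a0 aP] := fd _ (divr_gt0 e0 (ltr0n _ 2)).
  exists a => // k /andP[k0 /aP].
  have kn : k != 0 by rewrite -modulus_gt0.
  have -> : f (z + k) - f z - d * k = (q k - d) * k by rewrite /q (addrC k); field.
  rewrite modulusM ler_pM2r//; lra.
Qed.

End CircleMean.

(** * Uniform Taylor estimates *)

Section TaylorBound.
Context {R : realType}.
Local Notation C := (R[i])%C.
Implicit Types (f : C -> C) (z w k c d : C).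

Lemma linear_approx_is_derive (u : R -> R) (x l : R) :
  (forall e : R, 0 < e -> exists2 a : R, 0 < a &
    forall h : R, `|h| < a -> `|u (x + h) - u x - l * h| <= e * `|h|) ->
  is_derive x 1 u l.
Proof.
move=> H; have ul : (fun h : R => h^-1 *: (u (h *: 1 + x) - u x)) @ 0^' --> l.
  apply/cvgrPdist_le => /= e /H[a a0 aP].
  rewrite nearE /=; exists a => // k /=; rewrite sub0r normrN => ka k0.
  have := aP _ ka; have mk : 0 < `|k| by rewrite normr_gt0.
  rewrite -ler_pdivrMr// -normfV -normrM distrC => {}H.
  apply: le_trans H; rewrite le_eqVlt; apply/orP; left; apply/eqP.
  congr (`| _ |); rewrite /GRing.scale /= mulr1 (addrC k); by field.
by split; [apply/cvg_ex; exists l|exact/cvg_lim].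
Qed.

(** The mean value inequality on the segment from [z] to [z + k]: with [v] the
    increment, apply the real mean value theorem to the component along [v]. *)
Lemma mean_value_inequality f (f' : C -> C) z k c (L : R) :
  (forall w, cdiff f w (f' w)) ->
  (forall s : R, 0 <= s <= 1 -> modulus (f' (z + s%:C%C * k) - c) <= L) ->
  modulus (f (z + k) - f z - c * k) <= L * modulus k.
Proof.
move=> df f'L; set v := _ - c * k.
have L0 : 0 <= L.
  by apply: le_trans (f'L 0 _); rewrite ?modulus_ge0 ?lexx ?ler01.
have [->|v0] := eqVneq v 0; first by rewrite modulus0 mulr_ge0 ?modulus_ge0.
have mv : 0 < modulus v by rewrite modulus_gt0.
pose u (s : R) := complex.Re (conjc v * (f (z + s%:C%C * k) - c * (s%:C%C * k))).
pose u' (s : R) := complex.Re (conjc v * ((f' (z + s%:C%C * k) - c) * k)).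
have du (s : R) : is_derive s 1 u (u' s).
  apply: linear_approx_is_derive => e e0.
  have K0 : 0 < modulus v * (modulus k + 1).
    by rewrite mulr_gt0// ltr_wpDl// modulus_ge0.
  have [a a0 aP] := df (z + s%:C%C * k) _ (divr_gt0 e0 K0).
  have K1 : 0 < modulus k + 1 by rewrite ltr_wpDl// modulus_ge0.
  exists (a / (modulus k + 1)); first exact: divr_gt0.
  move=> h; rewrite ltr_pdivlMr// => ha.
  have hk : modulus (h%:C%C * k) = `|h| * modulus k by rewrite modulusM modulus_real.
  have : modulus (h%:C%C * k) < a.
    by rewrite hk; apply: le_lt_trans ha; rewrite ler_wpM2l// lerDl.
  move=> /aP; rewrite hk => H.
  have -> : u (s + h) - u s - u' s * h = complex.Re (conjc v *
     (f (z + s%:C%C * k + h%:C%C * k) - f (z + s%:C%C * k) - f' (z + s%:C%C * k) * (h%:C%C * k))).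
    rewrite /u /u'.
    have -> : z + (s + h)%:C%C * k = z + s%:C%C * k + h%:C%C * k.
      by rewrite raddfD mulrDl addrA.
    move: (f (z + s%:C%C * k + h%:C%C * k)) (f (z + s%:C%C * k)) (f' (z + s%:C%C * k)).
    case: (conjc v) (c) (k) => v1 v2 [c1 c2] [k1 k2] [x1 x2] [y1 y2] [w1 w2] /=.
    ring.
  apply: le_trans (Re_le_modulus _) _; rewrite modulusM modulus_conj.
    apply: le_trans (ler_wpM2l (ltW mv) H) _.
  have -> : modulus v * (e / (modulus v * (modulus k + 1)) * (`|h| * modulus k)) =
    e * `|h| * (modulus k / (modulus k + 1)) by field; rewrite !gt_eqF.
  by rewrite ler_piMr ?mulr_ge0 ?(ltW e0)// ler_pdivrMr// mul1r lerDl.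
have [||x x01] := @MVT R u u' 0 1 => //.
  apply: continuous_in_subspaceT => s _; apply/differentiable_continuous.
  by apply/derivable1_diffP; have [] := du s.
have -> : u 1 - u 0 = modulus v ^+ 2.
  rewrite /u !mul0r !mul1r addr0 mulr0 subr0 -raddfB -mulrBr /=.
  have -> : f (z + k) - c * k - f z = v by rewrite /v; ring.
  by rewrite modulus_sqr; case: (v) => p q /=; ring.
rewrite subr0 mulr1 => E; rewrite -(ler_pM2l mv) -expr2 E.
apply: le_trans (ler_norm _) _; apply: le_trans (Re_le_modulus _) _.
rewrite modulusM modulus_conj ler_pM2l// modulusM ler_wpM2r ?modulus_ge0// f'L//.
by move: x01; rewrite in_itv /= => /andP[/ltW -> /ltW ->].
Qed.

Lemma entire_increment f h : entire f -> entire (fun w => f (w + h) - f w).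
Proof.
move=> /entireP ef; apply/entireP => w.
have [d fd] := ef w; have [d' fd'] := ef (w + h).
by exists (d' - d); apply: cdiffB => //; exact: cdiff_shift.
Qed.

(** The derivative is Lipschitz on the disc because the Cauchy estimate applies
    to the increments of [f]; the mean value inequality then bounds the
    remainder. *)
Lemma entire_taylor f (f' : C -> C) (r : R) : entire f ->
  (forall w, cdiff f w (f' w)) -> 0 <= r ->
  exists2 M : R, 0 <= M & forall z k, modulus z <= r -> modulus k <= 1 ->
    [/\ modulus (f' z) <= M, modulus (f' (z + k) - f' z) <= M * modulus k &
        modulus (f (z + k) - f z - f' z * k) <= M * modulus k ^+ 2].
Proof.
(* The derivative is estimated at distance 3 from the disc, from values of [f]
   at distance 4; each later step loses one unit. *)
move=> ef df r0; have [B B0 BP] := entire_bounded_disc (r + 4) ef.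
have f'B z : modulus z <= r + 3 -> modulus (f' z) <= 2 * B.
  move=> zr; apply: (cauchy_estimate ef (df z)) => w w1.
  apply: le_trans (modulusB _ _) _.
  have := BP (z + w); have := BP z; have := modulusD z w; rewrite w1.
  by move=> h1 h2 h3; have := h2 ltac:(lra); have := h3 ltac:(lra); lra.
have seg z k (s : R) : 0 <= s <= 1 -> modulus (z + s%:C%C * k) <= modulus z + modulus k.
  move=> /andP[s0 s1]; apply: le_trans (modulusD _ _) _; rewrite modulusM modulus_nneg//.
  by rewrite lerD2l ler_piMl// modulus_ge0.
have fL z k : modulus z <= r + 2 -> modulus k <= 1 ->
    modulus (f (z + k) - f z) <= 2 * B * modulus k.
  move=> zr k1; have := @mean_value_inequality f f' z k 0 (2 * B) df.
  rewrite mul0r subr0; apply=> s s01; rewrite subr0; apply: f'B.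
  by have := seg z k s s01; lra.
have f'L z k : modulus z <= r + 1 -> modulus k <= 1 ->
    modulus (f' (z + k) - f' z) <= 4 * B * modulus k.
  move=> zr k1.
  have dg : cdiff (fun w => f (w + k) - f w) z (f' (z + k) - f' z).
    by apply: cdiffB => //; exact: cdiff_shift.
  have := @cauchy_estimate R _ z _ (4 * B * modulus k) (entire_increment ef) dg.
  apply=> w w1.
  apply: le_trans (modulusB _ _) _.
  have := fL z k; have := fL (z + w) k; have := modulusD z w; rewrite w1.
  by move=> h1 h2 h3; have := h2 ltac:(lra) k1; have := h3 ltac:(lra) k1; lra.
exists (4 * B) => [|z k zr k1]; first by rewrite mulr_ge0.
split; first by have := f'B z ltac:(lra); lra.
  by apply: f'L; lra.
rewrite expr2 mulrA; apply: mean_value_inequality => // s s01.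
have [s0 s1] := andP s01; have sk : modulus (s%:C%C * k) <= modulus k.
  by rewrite modulusM modulus_nneg// ler_piMl// modulus_ge0.
apply: le_trans (f'L _ _ _ _) _; [lra|lra|].
by rewrite ler_wpM2l// mulr_ge0.
Qed.

End TaylorBound.

(** * Averages of functions and Minkowski's inequality *)

Import HBSimple HBNNSimple.

Section MeasurePreliminaries.
Local Open Scope ereal_scope.
Context {R : realType} d (T : measurableType d).

(** The integral of a nonnegative function is a supremum over simple functions.
    This compares functions that are not known to be measurable, such as circle
    means as functions of the radius. *)
Lemma le_integral_scale (nu : {measure set T -> \bar R}) (D : set T)
    (f g : T -> \bar R) (c : R) : (0 < c)%R ->
  (forall x, D x -> 0 <= f x) -> (forall x, D x -> f x <= c%:E * g x) ->
  \int[nu]_(x in D) f x <= c%:E * \int[nu]_(x in D) g x.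
Proof.
move=> c0 f0 fg; have ci0 : (0 <= c^-1)%R by rewrite invr_ge0 ltW.
have g0 x : D x -> 0 <= g x.
  move=> Dx; have := le_trans (f0 _ Dx) (fg _ Dx).
  by rewrite pmule_rge0.
rewrite !ge0_integralE//; apply: ge_ereal_sup => _ [h /= hf <-].
have hg x : ((scale_nnsfun h ci0) x)%:E <= (g \_ D) x.
  have := hf x; rewrite !patchE; case: ifPn => [xD|_] H.
    have := le_trans H (fg x (set_mem xD)); rewrite /= EFinM.
    by rewrite lee_pdivrMl.
  by rewrite /= lee_fin mulr_ge0_le0// -lee_fin.
have := @ereal_sup_ubound R
  [set sintegral nu h | h in [set h : {nnsfun T >-> R} | forall x, (h x)%:E <= (g \_ D) x]]
  (sintegral nu (scale_nnsfun h ci0)).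
rewrite sintegralrM => H.
rewrite -lee_pdivrMl//; apply: H; exists (scale_nnsfun h ci0) => //.
by rewrite sintegralrM.
Qed.

Lemma le_integral_ge0 (nu : {measure set T -> \bar R}) (D : set T) (f g : T -> \bar R) :
  (forall x, D x -> 0 <= f x) -> (forall x, D x -> f x <= g x) ->
  \int[nu]_(x in D) f x <= \int[nu]_(x in D) g x.
Proof.
move=> f0 fg; have := @le_integral_scale nu D f g 1 ltr01 f0.
by rewrite mul1e; apply => x Dx; rewrite mul1e fg.
Qed.

(** A Caratheodory function is jointly measurable: it is the limit of the
    functions obtained by rounding its continuous variable down to a multiple
    of [1 / n]. *)
Lemma measurable_caratheodory (h : T -> R -> R) :
  (forall y, measurable_fun [set: T] (h ^~ y)) ->
  (forall t, continuous (h t)) ->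
  measurable_fun [set: T * R] (fun x => h x.1 `|x.2|%R).
Proof.
move=> mh ch; pose k n (x : T * R) := Num.trunc (n.+1%:R * `|x.2|)%R.
pose hn n (x : T * R) := h x.1 ((k n x)%:R / n.+1%:R)%R.
apply: (@measurable_fun_cvg _ _ _ _ hn) => [n|[t y] _].
- pose E j := [set x | k n x = j].
  have -> : [set: T * R] = \bigcup_j E j.
    by apply/esym/seteqP; split => // x _; exists (k n x).
  apply/measurable_fun_bigcup => [j|j].
    have mf : measurable_fun [set: T * R] (fun x => n.+1%:R * `|x.2|)%R.
      apply: measurable_funM; first exact: measurable_cst.
      by apply: measurableT_comp => //; exact: measurable_snd.
    rewrite (_ : E j = [set: T * R] `&` (fun x => n.+1%:R * `|x.2|)%R @^-1` `[j%:R, j.+1%:R[).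
      exact: mf.
    apply/seteqP; split => x; rewrite /E /k /= in_itv /=.
      by move=> <-; split => //; apply: truncn_itv; rewrite mulr_ge0.
    by move=> [_ xj]; apply/eqP; rewrite truncn_eq// mulr_ge0.
  apply: (eq_measurable_fun (fun x => h x.1 (j%:R / n.+1%:R)%R)).
    by move=> x /set_mem; rewrite /E /hn /= => ->.
  apply: (measurable_funS measurableT) => //.
  exact: (measurableT_comp (mh _) measurable_fst).
- rewrite /hn /k /=; apply: continuous_cvg; first exact: ch.
  apply/cvgrPdist_lt => e e0; near=> n.
  have n0 : (0 < n.+1%:R :> R)%R by [].
  have := truncn_itv (mulr_ge0 (ltW n0) (normr_ge0 y));
  set j := Num.trunc _ => /andP[j1 j2].
  rewrite ger0_norm; last by rewrite subr_ge0 ler_pdivrMr// mulrC.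
  apply: (@lt_trans _ _ n.+1%:R^-1%R); last first.
    by near: n; exact: (near_infty_natSinv_lt (PosNum e0)).
  by rewrite ltrBlDr -(ltr_pM2l n0) mulrDr divff ?gt_eqF// mulrCA divff ?gt_eqF// mulr1 addrC natr1.
Unshelve. all: by end_near. Qed.

End MeasurePreliminaries.

Section Averaging.
Local Open Scope ereal_scope.
Context {R : realType} d (T : measurableType d).
Variables (nu : {sigma_finite_measure set T -> \bar R}) (w : T -> R).
Variables (p K B : R).
Hypotheses (p1 : (1 <= p)%R) (K0 : (0 <= K)%R) (B0 : (0 <= B)%R).
Hypotheses (mw : measurable_fun [set: T] w) (w0 : forall t, (0 <= w t)%R).
Hypothesis wK : \int[nu]_t (w t)%:E = K%:E.

Let p0 : (0 < p)%R. Proof. exact: lt_le_trans ltr01 p1. Qed.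

(** The graph of [x `^ p] lies above its tangent at [m], by Young's inequality
    for the exponent [p] and its conjugate. *)
Lemma tangent_powR (x m : R) : (0 <= x)%R -> (0 <= m)%R ->
  (x * m `^ (p - 1) <= x `^ p / p + (1 - p^-1) * m `^ p)%R.
Proof.
move=> x0 m0; move: p1; rewrite le_eqVlt => /predU1P[<-|p1'].
  by rewrite invr1 !subrr mul0r addr0 powRr0 !mulr1 powRr1.
have q0 : (0 < p / (p - 1))%R by rewrite divr_gt0 ?subr_gt0.
have := @conjugate_powR R x (m `^ (p - 1))%R p (p / (p - 1))%R x0 (powR_ge0 _ _) p0 q0.
rewrite -powRrM.
have -> : ((p - 1) * (p / (p - 1)) = p)%R by field; rewrite subr_eq0 gt_eqF.
have -> : ((p / (p - 1))^-1 = 1 - p^-1)%R.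
  by field; rewrite subr_eq0 !gt_eqF.
by rewrite subrKC => /(_ erefl); rewrite (mulrC (m `^ p)%R).
Qed.

(** Jensen's inequality, by integrating [tangent_powR] with the tangent taken at
    the mean [m = s / K] of [h], where [s] is its weighted integral. *)
Lemma jensen_powR (h : T -> R) (u : R) : measurable_fun [set: T] h ->
  (forall t, (0 <= h t <= B)%R) -> (0 <= u)%R ->
  u%:E <= \int[nu]_t (w t * h t)%:E ->
  (u `^ p)%:E <= (K `^ (p - 1))%:E * \int[nu]_t (w t * h t `^ p)%:E.
Proof.
move=> mh h0B u0 uS.
have h0 t : (0 <= h t)%R by case/andP: (h0B t).
have I0 : 0 <= \int[nu]_t (w t * h t `^ p)%:E.
  by apply: integral_ge0 => t _; rewrite lee_fin mulr_ge0 ?powR_ge0.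
have [->|un0] := eqVneq u 0%R.
  by rewrite powR0 ?gt_eqF// mule_ge0// lee_fin powR_ge0.
have up : (0 < u)%R by rewrite lt_neqAle eq_sym un0.
set S := \int[nu]_t (w t * h t)%:E in uS.
have SB : S <= (B * K)%:E.
  rewrite EFinM -wK -ge0_integralZl; [|by []|exact/measurable_EFinP| |]; last 2 first.
  - by move=> t _; rewrite lee_fin.
  - by rewrite lee_fin.
  apply: le_integral_ge0 => t _; rewrite -?EFinM lee_fin ?mulr_ge0//.
  by rewrite mulrC ler_wpM2r//; case/andP: (h0B t).
have Kp : (0 < K)%R.
  rewrite lt_neqAle K0 andbT; apply/negP => /eqP KE.
  by have := le_trans uS SB; rewrite -KE mulr0 lee_fin leNgt up.
have Sf : S \is a fin_num.
  rewrite ge0_fin_numE; first exact: le_lt_trans SB (ltry _).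
  by apply: integral_ge0 => t _; rewrite lee_fin mulr_ge0.
set s := fine S; have SE : S = s%:E by rewrite fineK.
have us : (u <= s)%R by rewrite -lee_fin -SE.
have s0 : (0 < s)%R := lt_le_trans up us.
have mhp : measurable_fun [set: T] (fun t => h t `^ p)%R.
  by apply: (measurableT_comp (measurable_powR p)).
have mwh : measurable_fun [set: T] (fun t => (w t * h t `^ p)%:E).
  by apply/measurable_EFinP; exact: measurable_funM.
case IE : (\int[nu]_t (w t * h t `^ p)%:E) => [X||]; last 2 first.
- by rewrite gt0_muley ?leey// lte_fin powR_gt0.
- by rewrite IE in I0.
have X0 : (0 <= X)%R by rewrite -lee_fin -IE.
set m := (s / K)%R; have m0 : (0 < m)%R by rewrite divr_gt0.
have step : (s * m `^ (p - 1) <= X / p + (1 - p^-1) * m `^ p * K)%R.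
  rewrite -lee_fin EFinM -SE muleC /S -ge0_integralZl;
    [|by []|by apply/measurable_EFinP; exact: measurable_funM| |]; last 2 first.
  - by move=> t _; rewrite lee_fin mulr_ge0.
  - by rewrite lee_fin powR_ge0.
  have pc : (0 <= 1 - p^-1)%R by rewrite subr_ge0 invf_le1.
  rewrite EFinD (EFinM X) muleC -IE (EFinM (_ * _)) -wK.
  rewrite -ge0_integralZl; [|by []|exact: mwh| |]; last 2 first.
  - by move=> t _; rewrite lee_fin mulr_ge0 ?powR_ge0.
  - by rewrite lee_fin invr_ge0 ltW.
  rewrite -ge0_integralZl; [|by []|exact/measurable_EFinP| |]; last 2 first.
  - by move=> t _; rewrite lee_fin.
  - by rewrite lee_fin mulr_ge0 ?powR_ge0.
  rewrite -ge0_integralD; [|by []| | | |]; last 4 first.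
  - by move=> t _; rewrite -EFinM lee_fin !mulr_ge0 ?invr_ge0 ?powR_ge0// ltW.
  - exact: measurable_funeM.
  - by move=> t _; rewrite -EFinM lee_fin !mulr_ge0 ?powR_ge0.
  - by apply: measurable_funeM; exact/measurable_EFinP.
  apply: le_integral_ge0 => t _; rewrite -!EFinM ?lee_fin ?mulr_ge0 ?powR_ge0//.
  have := ler_wpM2l (w0 t) (tangent_powR (h0 t) (ltW m0)).
  lra.
have mp : (m `^ p = m * m `^ (p - 1))%R by rewrite mulr_powRB1// ltW.
have step2 : (m `^ p * K <= X)%R.
  have e1 : (s * m `^ (p - 1) = m `^ p * K)%R.
    by rewrite mp /m; field; rewrite gt_eqF.
  have : (m `^ p * K * p^-1 <= X / p)%R by move: step; rewrite e1; lra.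
  by rewrite ler_pM2r ?invr_gt0.
rewrite -EFinM lee_fin.
have -> : (K `^ (p - 1) = K `^ p / K)%R.
  by rewrite -(mulr_powRB1 K0 p0) mulrAC divff ?mul1r// gt_eqF.
apply: (@le_trans _ _ (s `^ p)%R); first by apply: ge0_ler_powR; rewrite ?nnegrE// ltW.
have -> : (s `^ p = K `^ p * m `^ p)%R.
  by rewrite -powRM ?(ltW Kp) ?(ltW m0)// /m mulrCA divff ?mulr1// gt_eqF.
by rewrite -mulrA ler_wpM2l ?powR_ge0// mulrC ler_pdivlMr.
Qed.

(** Minkowski's integral inequality for the weighted average of the functions
    [h t] on an interval, from Jensen's inequality and Tonelli's theorem. *)
Lemma average_Lp (a : R) (h : T -> R -> R) (u : R -> R) (A : R) :
  (forall y, measurable_fun [set: T] (h ^~ y)) -> (forall t, continuous (h t)) ->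
  (forall t y, (0 <= h t y <= B)%R) -> (0 <= A)%R ->
  (forall y, (0 <= u y)%R) ->
  (forall y, (u y)%:E <= \int[nu]_t (w t * h t y)%:E) ->
  (forall t, \int[lebesgue_measure]_(y in `[0%R, a]) (h t y `^ p)%:E <= A%:E) ->
  \int[lebesgue_measure]_(y in `[0%R, a]) (u y `^ p)%:E <= (K `^ p * A)%:E.
Proof.
move=> mh ch hB A0 u0 uh hA.
have h0 t y : (0 <= h t y)%R by case/andP: (hB t y).
pose D := `[0%R, a]%classic.
(* On [D] the absolute value is the identity; it is the form in which
   [measurable_caratheodory] applies. *)
pose g (x : T * R) : \bar R := (w x.1 * h x.1 `|x.2| `^ p * \1_D x.2)%:E.
have mD : measurable D by exact: measurable_itv.
have g0 x : 0 <= g x.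
  by rewrite lee_fin mulr_ge0 ?mulr_ge0 ?powR_ge0// indicE ler0n.
have mg : measurable_fun [set: T * R] g.
  apply/measurable_EFinP; apply: measurable_funM; first apply: measurable_funM.
  - exact: (measurableT_comp mw measurable_fst).
  - exact: (measurableT_comp (measurable_powR p) (measurable_caratheodory mh ch)).
  - by apply: (@measurableT_comp _ _ _ _ _ _ (\1_D : R -> R)) => //; exact: measurable_indic.
have D0 y : D y -> `|y|%R = y by rewrite /D /= in_itv /= => /andP[? _]; rewrite ger0_norm.
pose I y := \int[nu]_t (w t * h t y `^ p)%:E.
have I0 y : 0 <= I y by apply: integral_ge0 => t _; rewrite lee_fin mulr_ge0 ?powR_ge0.
have II : \int[lebesgue_measure]_(y in D) I y = \int[lebesgue_measure]_y \int[nu]_t g (t, y).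
  rewrite integral_mkcond; apply: eq_integral => y _; rewrite patchE /g /=.
  case: ifPn => yD.
    apply: eq_integral => t _; rewrite D0; last exact: set_mem.
    by rewrite indicE yD mulr1.
  by rewrite integral0_eq// => t _; rewrite indicE (negbTE yD) mulr0.
have JJ t : \int[lebesgue_measure]_y g (t, y) <= (w t * A)%:E.
  have -> : \int[lebesgue_measure]_y g (t, y) =
     \int[lebesgue_measure]_(y in D) ((w t)%:E * (h t y `^ p)%:E).
    rewrite [RHS]integral_mkcond; apply: eq_integral => y _; rewrite patchE /g /=.
    case: ifPn => yD; last by rewrite indicE (negbTE yD) mulr0.
    by rewrite D0 ?indicE ?yD ?mulr1 ?EFinM//; exact: set_mem.
  rewrite ge0_integralZl; [|by []| | |]; last 3 first.
  - apply/measurable_EFinP; apply: (measurableT_comp (measurable_powR p)).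
    apply: (measurable_funS measurableT) => //; exact: continuous_measurable_fun.
  - by move=> y _; rewrite lee_fin powR_ge0.
  - by rewrite lee_fin.
  by rewrite EFinM lee_wpmul2l ?lee_fin.
(* If [K = 0] then Jensen's inequality carries a factor [K `^ (p - 1)] that
   need not be positive, but [u] vanishes. *)
have [K00|Kp] := eqVneq K 0%R.
  rewrite K00 powR0 ?gt_eqF// mul0r integral0_eq// => y _.
  suff -> : (u y `^ p = 0)%R by [].
  have [uy|uy] := eqVneq (u y) 0%R; first by rewrite uy powR0// gt_eqF.
  have := uh y; have : \int[nu]_t (w t * h t y)%:E <= (B * K)%:E.
    rewrite EFinM -wK -ge0_integralZl; [|by []|exact/measurable_EFinP| |]; last 2 first.
    - by move=> t _; rewrite lee_fin.
    - by rewrite lee_fin.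
    apply: le_integral_ge0 => t _; rewrite -?EFinM lee_fin ?mulr_ge0//.
    by rewrite mulrC ler_wpM2r//; case/andP: (hB t y).
  rewrite K00 mulr0 => H1 H2; have := le_trans H2 H1.
  by rewrite lee_fin => H3; case/eqP: uy; apply/le_anti; rewrite H3 u0.
have K1 : (0 < K)%R by rewrite lt_neqAle eq_sym Kp.
apply: (@le_trans _ _ ((K `^ (p - 1))%:E * \int[lebesgue_measure]_(y in D) I y)).
  apply: le_integral_scale; first by rewrite powR_gt0.
    by move=> y _; rewrite lee_fin powR_ge0.
  by move=> y _; apply: jensen_powR.
have -> : (K `^ p * A = K `^ (p - 1) * (K * A))%R.
  by rewrite -(mulr_powRB1 K0 p0) mulrA (mulrC K).
have FT : \int[lebesgue_measure]_y \int[nu]_t g (t, y) = \int[nu]_t \int[lebesgue_measure]_y g (t, y).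
  by rewrite (@fubini_tonelli _ _ _ _ _ nu (@lebesgue_measure R) g mg g0).
rewrite EFinM lee_wpmul2l ?lee_fin ?powR_ge0// II FT.
rewrite EFinM muleC -wK -ge0_integralZl; [|by []| | |].
- apply: le_integral_ge0 => t _; first exact: integral_ge0.
  by rewrite muleC -EFinM.
- exact/measurable_EFinP.
- by move=> t _; rewrite lee_fin.
- by rewrite lee_fin.
Qed.

End Averaging.

(** * Monotonicity of the integral means *)

Section CircleMeanMonotone.
Context {R : realType}.
Local Notation C := (R[i])%C.
Local Notation mu := (@lebesgue_measure R).
Local Notation circle := `[0%R, (2 * pi)%R]%classic.
Implicit Types (f : C -> C) (u : R -> R).

Let pi2_gt0 : 0 < 2 * pi :> R.
Proof. by rewrite mulr_gt0 ?pi_gt0. Qed.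

Lemma Rintegral_shift u (a b c : R) : a <= b -> continuous u ->
  \int[mu]_(x in `[a + c, b + c]) u x = \int[mu]_(x in `[a, b]) u (x + c).
Proof.
move=> ab cu; pose F x : R := x + c.
have dF (x : R) : is_derive x (1 : R) F (1 + 0 : R) by apply: is_deriveD.
have F' : F^`()%classic = cst 1.
  by apply/funext => x; rewrite derive1E derive_val addr0.
have cF x : {for x, continuous F}.
  by apply: cvgD; [exact: cvg_id|exact: cvg_cst].
have := @integration_by_substitution_increasing R F u a b ab.
rewrite /Rintegral => ->.
- by congr fine; apply: eq_integral => x _; rewrite F' /= fctE /= mulr1.
- by move=> x y _ _ xy; rewrite /F ltrD2r.
- by rewrite F' => x _; exact: cst_continuous.
- by rewrite F'; exact: is_cvg_cst.
- by rewrite F'; exact: is_cvg_cst.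
- split => [x _||]; first by have [] := dF x.
    by apply: cvg_at_right_filter; exact: cF.
  by apply: cvg_at_left_filter; exact: cF.
- by apply: continuous_in_subspaceT => x _; exact: cu.
Qed.

Lemma Rintegral_rotate u (b : R) : continuous u ->
  (forall x, u (x + 2 * pi) = u x) -> 0 <= b <= 2 * pi ->
  \int[mu]_(x in circle) u (x + b) = \int[mu]_(x in circle) u x.
Proof.
move=> cu per /andP[b0 b2].
have ci (c d : R) : {in `[c, d], continuous u} by move=> x _; exact: cu.
have := @Rintegral_shift u 0 (2 * pi) b (ltW pi2_gt0) cu; rewrite add0r => <-.
have E : \int[mu]_(x in `[2 * pi, 2 * pi + b]) u x = \int[mu]_(x in `[0, b]) u x.
  have := @Rintegral_shift u 0 b (2 * pi) b0 cu; rewrite add0r (addrC b) => ->.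
  by apply: eq_Rintegral => x _; exact: per.
rewrite (@Rintegral_itv_split _ u b (2 * pi) (2 * pi + b))//; last by rewrite lerDl.
by rewrite E addrC -Rintegral_itv_split.
Qed.

Lemma polar_period (r t : R) : polar r (t + 2 * pi) = polar r t.
Proof.
have -> : 2 * pi = pi *+ 2 :> R by rewrite mulr2n; ring.
by rewrite /polar cosD2pi sinD2pi.
Qed.

Lemma continuous_modulus_circle f (r : R) : entire f ->
  continuous (fun t => modulus (f (polar r t))).
Proof.
move=> ef t; apply: (@curve_cont_modulus _ (f \o polar r)).
by apply: entire_curve => //; exact: curve_cont_polar.
Qed.

(** Where [u] vanishes, [x `^ p] is not differentiable in general and continuity
    is checked by inverting the power. *)
Lemma continuous_powR_nneg u (p : R) : 0 < p -> (forall t, 0 <= u t) ->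
  continuous u -> continuous (fun t => u t `^ p).
Proof.
move=> p0 u0 cu t; have [ut|ut] := eqVneq (u t) 0.
  rewrite /continuous_at ut powR0 ?gt_eqF//; apply/cvgrPdist_lt => e e0.
  have e1 : 0 < e `^ p^-1 by exact: powR_gt0.
  have /cvgrPdist_lt/(_ _ e1) := cu t; apply: filterS => s.
  rewrite ut !sub0r !normrN ger0_norm// ger0_norm ?powR_ge0// => H.
  have -> : e = (e `^ p^-1) `^ p by rewrite -powRrM mulVf ?gt_eqF// powRr1// ltW.
  by apply: gt0_ltr_powR; rewrite ?nnegrE// ltW.
apply: (@continuous_comp _ _ _ u (fun x => x `^ p)); first exact: cu.
apply/differentiable_continuous/derivable1_diffP/derivable_powR.
by rewrite in_itv /= andbT lt_neqAle eq_sym ut u0.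
Qed.

(** Multiplication by [w = polar 1 b] shifts the angle by [b], which does not
    change the integral over a period. *)
Lemma integral_rotate_powR f (p r : R) w : 0 < p -> entire f -> modulus w = 1 ->
  \int[mu]_(y in circle) (modulus (f (polar r y * w)) `^ p) =
  \int[mu]_(y in circle) (modulus (f (polar r y)) `^ p).
Proof.
move=> p0 ef w1; have [b b2 ->] := polar_surj w; rewrite w1.
pose u y := modulus (f (polar r y)) `^ p.
have cu : continuous u.
  apply: continuous_powR_nneg => // [t|]; first exact: modulus_ge0.
  exact: continuous_modulus_circle.
have pu x : u (x + 2 * pi) = u x by rewrite /u polar_period.
apply: etrans (Rintegral_rotate cu pu b2).
by apply: eq_Rintegral => y _; rewrite polarM mulr1.
Qed.

Lemma integral_circle_EFin u : continuous u ->
  (\int[mu]_(y in circle) (u y)%:E)%E = (\int[mu]_(y in circle) u y)%:E.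
Proof.
move=> cu; rewrite /Rintegral fineK//; apply: integrable_fin_num => //.
by apply: integrable_itv => x _; exact: cu.
Qed.

(** With [rho = r * k], the value of [f] at [polar rho y] is the mean over [t] of
    its values at [polar r y * moebius k (polar 1 t)]. These points lie on the
    circle of radius [r] and, for fixed [t], they describe that circle by
    rotation as [y] varies. *)
Lemma Lp_circle_mono f (p rho r : R) : entire f -> 1 <= p -> 0 <= rho <= r ->
  (\int[mu]_(y in circle) (modulus (f (polar rho y)) `^ p)%:E <=
   \int[mu]_(y in circle) (modulus (f (polar r y)) `^ p)%:E)%E.
Proof.
move=> ef p1 /andP[rho0]; rewrite le_eqVlt => /predU1P[->//|rr].
have r0 : 0 < r := le_lt_trans rho0 rr.
have p0 : 0 < p := lt_le_trans ltr01 p1.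
have cp s : continuous (fun y => modulus (f (polar s y)) `^ p).
  apply: continuous_powR_nneg => // [t|]; first exact: modulus_ge0.
  exact: continuous_modulus_circle.
pose k := rho / r.
have kk : 0 <= k < 1 by rewrite divr_ge0 ?(ltW r0)//= ltr_pdivrMr// mul1r.
have [B B0 BP] := entire_bounded_disc r ef.
pose h t y := modulus (f (polar r y * moebius k (polar 1 t))).
have rm t y : modulus (polar r y * moebius k (polar 1 t)) = r.
  by rewrite modulusM modulus_polar ?(ltW r0)// modulus_moebius ?mulr1// modulus_polar.
have cht y : continuous (h ^~ y).
  move=> t; apply: (@curve_cont_modulus _ (fun t => f (polar r y * moebius k (polar 1 t)))).
  exact: curve_cont_moebius.
have chy t : continuous (h t).
  move=> y; apply: (@curve_cont_modulus _ (f \o (fun y => polar r y * moebius k (polar 1 t)))).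
  apply: entire_curve => //.
  have -> : (fun y => polar r y * moebius k (polar 1 t)) =
     (fun y => 0 + r%:C%C * moebius k (polar 1 t) * polar 1 y).
    by apply/funext => s; rewrite add0r polarE; ring.
  exact: curve_cont_circle.
pose w (t : R) : R := \1_circle t / (2 * pi).
have w0 t : 0 <= w t by rewrite divr_ge0 ?(ltW pi2_gt0)// indicE ler0n.
have mw : measurable_fun setT w.
  by apply: measurable_funM => //; exact: measurable_indic.
have wint (v : R -> R) : continuous v -> (forall t, 0 <= v t) ->
   (\int[mu]_t (w t * v t)%:E = ((\int[mu]_(t in circle) v t) / (2 * pi))%:E)%E.
  move=> cv v0; rewrite EFinM -integral_circle_EFin// muleC.
  rewrite -ge0_integralZl; [|exact: measurable_itv| | |]; last 3 first.
  - apply/measurable_EFinP; apply: (measurable_funS measurableT) => //.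
    exact: continuous_measurable_fun.
  - by move=> x _; rewrite lee_fin.
  - by rewrite lee_fin invr_ge0 ltW.
  rewrite [RHS]integral_mkcond; apply: eq_integral => t _.
  rewrite patchE /w indicE; case: ifPn => tc.
    by rewrite /= -EFinM div1r.
  by rewrite /= !mul0r.
rewrite (integral_circle_EFin (cp r)); set A := \int[mu]_(y in circle) _.
have A0 : 0 <= A by apply: Rintegral_ge0 => y _; exact: powR_ge0.
have wK : (\int[mu]_t (w t)%:E = 1%:E)%E.
  have := @wint (cst 1) ltac:(exact: cst_continuous) ltac:(by move=> t).
  rewrite Rintegral_itv_cst ?(ltW pi2_gt0)// subr0 mul1r divff ?gt_eqF// => <-.
  by apply: eq_integral => t _; rewrite mulr1.
have -> : A = 1 `^ p * A by rewrite powR1 mul1r.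
apply: (@average_Lp R _ _ mu w p 1 B p1 ler01 B0 mw w0 wK (2 * pi) h) => //.
- by move=> y; apply: continuous_measurable_fun => t; exact: cht.
- by move=> t y; rewrite modulus_ge0 /h BP// rm.
- by move=> y; exact: modulus_ge0.
- move=> y; rewrite wint; last 2 first.
  + by move=> t; exact: cht.
  + by move=> t; exact: modulus_ge0.
  rewrite lee_fin ler_pdivlMr//.
  have -> : polar rho y = polar r y * k%:C%C.
    by rewrite -polar_at0 polarM addr0; congr polar; rewrite /k mulrCA divff ?mulr1// gt_eqF.
  have -> : modulus (f (polar r y * k%:C%C)) * (2 * pi) =
      modulus ((2 * pi)%:C%C * f (polar r y * k%:C%C)).
    by rewrite modulusM modulus_nneg ?(ltW pi2_gt0)// mulrC.
  rewrite -moebius_mean_value//; apply: modulus_cintegral_le => //.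
    by apply: cintegrable_itv => t _; exact: curve_cont_moebius.
  by apply: integrable_itv => t _; exact: cht.
- move=> t; rewrite integral_circle_EFin.
    have m1 : modulus (moebius k (polar 1 t)) = 1.
      by rewrite modulus_moebius// modulus_polar.
    by have E := integral_rotate_powR r p0 ef m1; rewrite lee_fin E.
  by apply: continuous_powR_nneg => // y; exact: modulus_ge0.
Qed.

End CircleMeanMonotone.

(** * The Hausdorff operator of a measure carried by the half-line [[1, +oo)] *)

Section HausdorffSupport.
Context {R : realType}.
Local Notation C := (R[i])%C.
Implicit Types (f : C -> C) (z : C).

Lemma curve_contM (F G : R -> C) t : curve_cont F t -> curve_cont G t ->
  curve_cont (fun s => F s * G s) t.
Proof.
move=> cF cG e e0.
have D1 : 0 < modulus (F t) + 1 by rewrite ltr_wpDl ?modulus_ge0.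
have D2 : 0 < modulus (G t) + 1 by rewrite ltr_wpDl ?modulus_ge0.
have [a a0 aP] := cF (Num.min 1 (e / 2 / (modulus (G t) + 1)))
  ltac:(by rewrite lt_min ltr01 !divr_gt0).
have [b b0 bP] := cG (e / 2 / (modulus (F t) + 1)) ltac:(by rewrite !divr_gt0).
exists (Num.min a b); first by rewrite lt_min a0.
move=> s; rewrite lt_min => /andP[/aP + /bP]; rewrite lt_min => /andP[F1 Fs] Gs.
have -> : F s * G s - F t * G t = F s * (G s - G t) + (F s - F t) * G t by ring.
apply: le_lt_trans (modulusD _ _) _; rewrite !modulusM.
have Fs1 : modulus (F s) <= modulus (F t) + 1.
  by have := modulus_le_dist (F s) (F t); lra.
have e1 : modulus (F s) * modulus (G s - G t) < e / 2.
  apply: le_lt_trans (ler_wpM2r (modulus_ge0 _) Fs1) _.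
  by rewrite mulrC -ltr_pdivlMr.
have e2 : modulus (F s - F t) * modulus (G t) <= e / 2.
  apply: (@le_trans _ _ (modulus (F s - F t) * (modulus (G t) + 1))).
    by rewrite ler_wpM2l ?modulus_ge0// lerDl.
  by rewrite -ler_pdivlMr// ltW.
lra.
Qed.

Lemma curve_cont_dilate f z (t : R) : (forall w, ccont f w) -> 0 < t ->
  curve_cont (fun s => f (z / s%:C%C)) t.
Proof.
move=> cf t0.
have -> : (fun s => f (z / s%:C%C)) = f \o (fun s => z * s^-1%:C%C).
  by apply/funext => s /=; rewrite fmorphV.
apply: curve_cont_comp => //; apply: (@curve_cont_comp _ ( *%R z)); first exact: ccontMl.
apply: curve_cont_real; apply: inv_continuous; by rewrite gt_eqF.
Qed.

Lemma entire_ccont f : entire f -> forall w, ccont f w.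
Proof. by move=> /entireP ef w; have [d /cdiff_ccont] := ef w. Qed.

Lemma curve_cont_inv (t : R) : 0 < t -> curve_cont (fun s : R => (s^-1)%:C%C) t.
Proof. by move=> t0; apply: curve_cont_real; apply: inv_continuous; rewrite gt_eqF. Qed.

Lemma measurable_curve (D : set (measurableTypeR R)) (F : R -> C) : measurable D ->
  (forall t, D t -> curve_cont F t) ->
  measurable_fun D (fun t => complex.Re (F t)) /\
  measurable_fun D (fun t => complex.Im (F t)).
Proof.
move=> mD cF; split; apply: subspace_continuous_measurable_fun => //;
  apply: continuous_in_subspaceT => t /set_mem /cF.
  exact: curve_cont_Re.
exact: curve_cont_Im.
Qed.

End HausdorffSupport.

Section HausdorffContraction.
Context {R : realType}.
Local Notation C := (R[i])%C.
Variable mu : {measure set (measurableTypeR R) -> \bar R}.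
Local Notation ray := `[1%R, +oo[%classic.
Local Notation pos := `]0%R, +oo[%classic.
Implicit Types (f : C -> C) (z : C).
Hypothesis mu01 : mu `]0%R, 1%R[%classic = 0%E.
Variable K : R.
Hypothesis muK : (\int[mu]_(t in ray) (t^-1)%:E = K%:E)%E.

Let mray : measurable (ray : set (measurableTypeR R)).
Proof. exact: measurable_itv. Qed.

Let mpos : measurable (pos : set (measurableTypeR R)).
Proof. exact: measurable_itv. Qed.

Let m01 : measurable (`]0%R, 1%R[%classic : set (measurableTypeR R)).
Proof. exact: measurable_itv. Qed.

Let ray_gt0 (t : R) : ray t -> 0 < t.
Proof. by rewrite /= in_itv /= andbT; exact: lt_le_trans. Qed.

Let pos_gt0 (t : R) : pos t -> 0 < t.
Proof. by rewrite /= in_itv /= andbT. Qed.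

Let ray_inv (t : R) : ray t -> 0 <= t^-1 <= 1.
Proof.
move=> /[dup] rt /ray_gt0 t0; rewrite invr_ge0 (ltW t0) /= invf_le1//.
by move: rt; rewrite /= in_itv /= andbT.
Qed.

Lemma weighted_mass_ge0 : 0 <= K.
Proof.
rewrite -lee_fin -muK; apply: integral_ge0 => t /ray_gt0 t0.
by rewrite lee_fin invr_ge0 ltW.
Qed.

Lemma pos_setD : pos `\` `]0%R, 1%R[%classic = ray :> set R.
Proof.
apply/seteqP; split => t /=; rewrite !in_itv /= !andbT.
  by move=> [t0 /negP]; rewrite t0 /= -leNgt.
by move=> t1; split; [exact: lt_le_trans t1|rewrite (ltNge t) t1 andbF].
Qed.

(** Since [(0, 1)] is null, the operator only sees the dilations by [1 / t] with
    [t >= 1], which map every disc centred at 0 into itself. *)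
Lemma integrable_pos_ray (u : R -> R) : measurable_fun (pos : set (measurableTypeR R)) u ->
  mu.-integrable ray (EFin \o u) ->
  mu.-integrable pos (EFin \o u) /\
  \int[mu]_(t in pos) u t = \int[mu]_(t in ray) u t.
Proof.
move=> mu_ iu; have ip : mu.-integrable pos (EFin \o u).
  apply/(negligible_integrable m01 mpos _ mu01); first exact/measurable_EFinP.
  by rewrite pos_setD.
by split => //; rewrite /Rintegral (negligible_integral m01 mpos ip mu01) pos_setD.
Qed.

Lemma measurable_inv_ray : measurable_fun (ray : set (measurableTypeR R)) (fun t : R => t^-1).
Proof.
apply: subspace_continuous_measurable_fun => //.
apply: continuous_in_subspaceT => t /set_mem /ray_gt0 t0.
by apply: inv_continuous; rewrite gt_eqF.
Qed.

Lemma integrable_inv_ray (M : R) : mu.-integrable ray (EFin \o (fun t : R => M * t^-1)).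
Proof.
apply: (integrableZl mray M (f := fun t : R => (t^-1)%:E)).
apply/integrableP; split; first by apply/measurable_EFinP; exact: measurable_inv_ray.
suff -> : (\int[mu]_(t in ray) `|(t^-1)%:E| = K%:E)%E by rewrite ltry.
rewrite -muK; apply: eq_integral.
by move=> t /set_mem /ray_gt0 t0; rewrite gee0_abs// lee_fin invr_ge0 ltW.
Qed.

Lemma Rintegral_inv_ray (M : R) : \int[mu]_(t in ray) (M * t^-1) = M * K.
Proof.
rewrite RintegralZl//; first by rewrite /Rintegral muK.
have := integrable_inv_ray 1; congr (mu.-integrable _ _).
by apply/funext => t /=; rewrite mul1r.
Qed.

Lemma dilate_le z (t : R) : ray t -> modulus (z / t%:C%C) <= modulus z.
Proof.
move=> rt; have /andP[t0 t1] := ray_inv rt.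
rewrite modulusM modulusV modulus_nneg ?(ltW (ray_gt0 rt))//.
by rewrite ler_piMr// modulus_ge0.
Qed.

Lemma curve_cont_integrand f z (t : R) : entire f -> 0 < t ->
  curve_cont (hausdorff_integrand f z) t.
Proof.
move=> ef t0; apply: curve_contM; first exact: curve_cont_inv.
by apply: curve_cont_dilate => //; exact: entire_ccont.
Qed.

Lemma modulus_integrand f z (t : R) : ray t ->
  modulus (hausdorff_integrand f z t) = modulus (f (z / t%:C%C)) * t^-1.
Proof.
move=> /ray_gt0 t0; rewrite /hausdorff_integrand modulusM modulus_nneg 1?mulrC//.
by rewrite invr_ge0 ltW.
Qed.

Lemma cintegrable_integrand f z : entire f ->
  cintegrable mu ray (hausdorff_integrand f z).
Proof.
move=> ef; have [M M0 MP] := entire_bounded_disc (modulus z) ef.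
have [mRe mIm] := measurable_curve mray (F := hausdorff_integrand f z)
   (fun t rt => curve_cont_integrand z ef (ray_gt0 rt)).
apply: (cintegrable_dominated mray mRe mIm _ (integrable_inv_ray M)) => t rt.
rewrite modulus_integrand// ler_wpM2r//; last exact/MP/dilate_le.
by case/andP: (ray_inv rt).
Qed.

Lemma hausdorff_ray f z : entire f ->
  hausdorff_defined mu f /\ hausdorff mu f z = cintegral mu ray (hausdorff_integrand f z).
Proof.
move=> ef; have pos_ray w := measurable_curve mpos (F := hausdorff_integrand f w)
  (fun t pt => curve_cont_integrand w ef (pos_gt0 pt)).
split=> [w|].
  have [mRe mIm] := pos_ray w; have [iRe iIm] := cintegrable_integrand w ef.
  by split; [case: (integrable_pos_ray mRe iRe)|case: (integrable_pos_ray mIm iIm)].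
have [mRe mIm] := pos_ray z; have [iRe iIm] := cintegrable_integrand z ef.
rewrite /hausdorff /cintegral.
by have [_ ->] := integrable_pos_ray mRe iRe; have [_ ->] := integrable_pos_ray mIm iIm.
Qed.

Lemma hausdorff_linear f g (a : C) : entire f -> entire g ->
  hausdorff mu (fun z => a * f z + g z) =
  (fun z => a * hausdorff mu f z + hausdorff mu g z).
Proof.
move=> ef eg; apply/funext => z.
have eh : entire (fun z => a * f z + g z).
  apply/entireP => w; have [d fd] := (entireP f).1 ef w.
  have [d' gd] := (entireP g).1 eg w; exists (a * d + d').
  by apply: cdiffD => //; exact: cdiffZ.
have [_ ->] := hausdorff_ray z eh; have [_ ->] := hausdorff_ray z ef.
have [_ ->] := hausdorff_ray z eg.
have iF := cintegrable_integrand z ef; have iG := cintegrable_integrand z eg.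
rewrite -cintegralZ// -cintegralD//; last exact: cintegrableZ.
congr cintegral; apply/funext => t; rewrite /hausdorff_integrand; ring.
Qed.

(** Differentiation under the integral sign, by the uniform Taylor estimate on
    the disc of radius [|z|], which contains all the points [z / t]. *)
Lemma entire_hausdorff f : entire f -> entire (hausdorff mu f).
Proof.
move=> ef; have /choice[f' df] := (entireP f).1 ef.
apply/entireP => z; have [M M0 MP] := entire_taylor ef df (modulus_ge0 z).
(* The integrand of the candidate derivative. *)
pose D (t : R) : C := (t^-1)%:C%C * ((t^-1)%:C%C * f' (z / t%:C%C)).
have cf' w : ccont f' w.
  (* [f'] is Lipschitz near [w]. *)
  have [L L0 LP] := entire_taylor ef df (modulus_ge0 w) => e e0.
  have L1 : 0 < L + 1 by rewrite ltr_wpDl.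
  exists (Num.min 1 (e / (L + 1))); first by rewrite lt_min ltr01 divr_gt0.
  move=> k; rewrite lt_min ltr_pdivlMr// => /andP[/ltW k1 ke].
  have [_ H _] := LP w k (lexx _) k1; apply: le_lt_trans H _.
  by apply: le_lt_trans ke; rewrite mulrC ler_wpM2l ?modulus_ge0// lerDl.
have cD t : 0 < t -> curve_cont D t.
  move=> t0; apply: curve_contM; first exact: curve_cont_inv.
  apply: curve_contM; first exact: curve_cont_inv.
  exact: curve_cont_dilate.
have [mRe mIm] := measurable_curve mray (F := D) (fun t rt => cD t (ray_gt0 rt)).
have iD : cintegrable mu ray D.
  apply: (cintegrable_dominated mray mRe mIm _ (integrable_inv_ray M)) => t rt.
  have /andP[t0 t1] := ray_inv rt; rewrite /D !modulusM !modulus_nneg// mulrC.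
  rewrite ler_wpM2r//; have [H _ _] := MP (z / t%:C%C) 0 (dilate_le z rt) ltac:(by rewrite modulus0).
  apply: le_trans H; by rewrite ler_piMl// modulus_ge0.
exists (cintegral mu ray D) => e e0.
have MK : 0 < M * K + 1 by rewrite ltr_wpDl ?mulr_ge0 ?weighted_mass_ge0.
exists (Num.min 1 (e / (M * K + 1))); first by rewrite lt_min ltr01 divr_gt0.
move=> k; rewrite lt_min ltr_pdivlMr// => /andP[/ltW k1 ke].
have [_ ->] := hausdorff_ray (z + k) ef; have [_ ->] := hausdorff_ray z ef.
have iF w := cintegrable_integrand w ef.
rewrite [_ * k]mulrC -cintegralZ// -cintegralB// -cintegralB//; last 2 first.
- exact: cintegrableB.
- exact: cintegrableZ.
apply: (@le_trans _ _ (\int[mu]_(t in ray) ((M * modulus k ^+ 2) * t^-1))).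
  apply: modulus_cintegral_le => //.
  - by apply: cintegrableB => //; [exact: cintegrableB|exact: cintegrableZ].
  - move=> t rt; have /andP[t0 t1] := ray_inv rt.
    have kt : modulus (k / t%:C%C) <= modulus k by exact: dilate_le.
    have [_ _ H] := MP (z / t%:C%C) (k / t%:C%C) (dilate_le z rt) (le_trans kt k1).
    have -> : hausdorff_integrand f (z + k) t - hausdorff_integrand f z t - k * D t =
      (t^-1)%:C%C * (f (z / t%:C%C + k / t%:C%C) - f (z / t%:C%C)
         - f' (z / t%:C%C) * (k / t%:C%C)).
      by rewrite /hausdorff_integrand /D mulrDl fmorphV; ring.
    rewrite modulusM modulus_nneg// mulrC ler_wpM2r//.
    apply: le_trans H _; rewrite ler_wpM2l//.
    by rewrite lerXn2r// nnegrE modulus_ge0.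
  - exact: integrable_inv_ray.
rewrite Rintegral_inv_ray.
have -> : M * modulus k ^+ 2 * K = (M * K * modulus k) * modulus k by ring.
by rewrite ler_wpM2r ?modulus_ge0//; have := modulus_ge0 k; lra.
Qed.

Lemma integrable_modulus_integrand f z : entire f ->
  mu.-integrable ray (EFin \o (fun t => modulus (f (z / t%:C%C)) * t^-1)).
Proof.
move=> ef; have [M M0 MP] := entire_bounded_disc (modulus z) ef.
apply: (le_integrable mray _ _ (integrable_inv_ray M)).
  apply/measurable_EFinP; apply: measurable_funM; last exact: measurable_inv_ray.
  apply: subspace_continuous_measurable_fun => //.
  apply: continuous_in_subspaceT => t /set_mem /ray_gt0 t0.
  apply: (@curve_cont_modulus _ (fun s => f (z / s%:C%C))).
  by apply: curve_cont_dilate => //; exact: entire_ccont.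
move=> t rt /=; have /andP[t0 _] := ray_inv rt.
by rewrite lee_fin !ger0_norm ?mulr_ge0 ?modulus_ge0// ler_wpM2r// MP// dilate_le.
Qed.

Lemma modulus_hausdorff_le f z : entire f ->
  modulus (hausdorff mu f z) <= \int[mu]_(t in ray) (modulus (f (z / t%:C%C)) * t^-1).
Proof.
move=> ef; have [_ ->] := hausdorff_ray z ef.
apply: modulus_cintegral_le => //; first exact: cintegrable_integrand.
  by move=> t rt; rewrite modulus_integrand.
exact: integrable_modulus_integrand.
Qed.

(** The restriction of [mu] to the half-line is sigma-finite, since the
    integral of [1 / t] bounds the measure of [[1, n]] by [n * K]. *)
Definition mu_ray := mrestr mu mray.

HB.instance Definition _ := Measure.on mu_ray.

Lemma mu_ray_sigma_finite : sigma_finite setT mu_ray.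
Proof.
exists (fun n : nat => `]-oo, n.+1%:R[%classic).
  apply/esym/seteqP; split => // t _; exists (Num.trunc t) => //=.
  by rewrite in_itv /= truncnS_gt.
move=> n; set I := `]-oo, _[%classic.
have mI : measurable (I : set (measurableTypeR R)) by exact: measurable_itv.
split => //; rewrite /mu_ray /mrestr.
have n0 : 0 < n.+1%:R^-1 :> R by rewrite invr_gt0.
have H : ((n.+1%:R^-1)%:E * mu (I `&` ray) <= K%:E)%E.
  rewrite -integral_cst; last exact: measurableI.
  rewrite -muK; apply: (@le_trans _ _ (\int[mu]_(t in I `&` ray) (t^-1)%:E)%E).
    apply: le_integral_ge0 => t [tI rt]; rewrite lee_fin ?(ltW n0)//.
    rewrite lef_pV2 ?posrE ?(ray_gt0 rt)//.
    by move: tI; rewrite /I /= in_itv /= => /ltW.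
  apply: ge0_subset_integral => //; first exact: measurableI.
  - by apply/measurable_EFinP; exact: measurable_inv_ray.
  - by move=> t /ray_inv/andP[t0 _]; rewrite lee_fin.
have Mf : (mu (I `&` ray) <= (n.+1%:R * K)%:E)%E.
  by rewrite EFinM -lee_pdivrMl.
exact: le_lt_trans Mf (ltry _).
Qed.

HB.instance Definition _ := @Measure_isSigmaFinite.Build _ _ _ mu_ray mu_ray_sigma_finite.

Lemma integral_mu_ray (v : R -> R) : measurable_fun setT v -> (forall t, 0 <= v t) ->
  (\int[mu_ray]_t (v t)%:E = \int[mu]_(t in ray) (v t)%:E)%E.
Proof.
move=> mv v0; have mC : measurable (~` ray : set (measurableTypeR R)).
  exact: measurableC.
rewrite (ge0_negligible_integral mC measurableT) => //.
- rewrite setTD setCK; apply: eq_measure_integral => A mA Aray.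
  by rewrite /mu_ray /mrestr; congr (mu _); exact: setIidl.
- exact/measurable_EFinP.
- by move=> t _; rewrite lee_fin.
- transitivity (mu set0); last exact: measure0.
  by congr (mu _); exact: setICl.
Qed.

(** [clamp] extends the identity of the half-line continuously to the line. *)
Let clamp (t : R) : R := Num.max t 1.

Let clamp_ge1 t : 1 <= clamp t.
Proof. by rewrite le_max lexx orbT. Qed.

Let clamp_gt0 t : 0 < clamp t.
Proof. exact: lt_le_trans ltr01 (clamp_ge1 t). Qed.

Let clamp_id t : ray t -> clamp t = t.
Proof. by rewrite /= in_itv /= andbT => t1; apply/max_idPl. Qed.

Let continuous_clamp : continuous clamp.
Proof. by move=> t; apply: continuous_max; [exact: cvg_id|exact: cst_continuous]. Qed.

(** On the circle of radius [r], the image of [f] is an average over [t], with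
    total weight [K], of the functions [f] on the circles of radius [r / t];
    by monotonicity all their means are at most the mean of [f] on the circle
    of radius [r]. *)
Lemma Lp_hausdorff f (p r : R) : entire f -> 1 <= p -> 0 <= r ->
  (\int[lebesgue_measure]_(y in `[0%R, (2 * pi)%R])
     (modulus (hausdorff mu f (polar r y)) `^ p)%:E <=
   (K `^ p)%:E * \int[lebesgue_measure]_(y in `[0%R, (2 * pi)%R])
     (modulus (f (polar r y)) `^ p)%:E)%E.
Proof.
move=> ef p1 r0; have p0 : 0 < p := lt_le_trans ltr01 p1.
have [B B0 BP] := entire_bounded_disc r ef.
pose h (t y : R) := modulus (f (polar r y / (clamp t)%:C%C)).
pose w (t : R) := (clamp t)^-1.
have hB t y : 0 <= h t y <= B.
  rewrite modulus_ge0; apply: BP; rewrite modulusM modulusV modulus_polar//.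
  rewrite modulus_nneg ?(ltW (clamp_gt0 t))// ler_piMr// invf_le1 ?clamp_gt0//.
have w0 t : 0 <= w t by rewrite invr_ge0 ltW.
have cw : continuous w.
  move=> t; apply: (@continuous_comp _ _ _ clamp (@GRing.inv R)); first exact: continuous_clamp.
  by apply: inv_continuous; rewrite gt_eqF.
have mw : measurable_fun setT w by exact: continuous_measurable_fun.
have mh y : measurable_fun setT (h ^~ y).
  apply: continuous_measurable_fun => t.
  apply: (@continuous_comp _ _ _ clamp (fun s : R => modulus (f (polar r y / s%:C%C)))).
    exact: continuous_clamp.
  apply: (@curve_cont_modulus _ (fun s => f (polar r y / s%:C%C))).
  by apply: curve_cont_dilate => //; exact: entire_ccont.
have hE t y : h t y = modulus (f (polar (r / clamp t) y)).
  by rewrite /h polarE [in RHS]polarE -fmorphV rmorphM /= mulrAC.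
have ch t : continuous (h t).
  rewrite (_ : h t = fun y => modulus (f (polar (r / clamp t) y))).
    exact: continuous_modulus_circle.
  by apply/funext => y; exact: hE.
have wK : (\int[mu_ray]_t (w t)%:E = K%:E)%E.
  rewrite integral_mu_ray// -muK; apply: eq_integral => t /set_mem rt.
  by rewrite /w clamp_id.
rewrite (@integral_circle_EFin _ (fun y => modulus (f (polar r y)) `^ p)); last first.
  by apply: continuous_powR_nneg => // [t|]; [exact: modulus_ge0|exact: continuous_modulus_circle].
rewrite -EFinM.
apply: (@average_Lp R _ _ mu_ray w p K B p1 weighted_mass_ge0 B0 mw w0 wK (2 * pi) h) => //.
- by apply: Rintegral_ge0 => y _; exact: powR_ge0.
- by move=> y; exact: modulus_ge0.
- move=> y; rewrite integral_mu_ray; last 2 first.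
  + exact: measurable_funM.
  + by move=> t; rewrite mulr_ge0 ?modulus_ge0.
  have <- : (\int[mu]_(t in ray) (modulus (f (polar r y / t%:C%C)) * t^-1)%:E =
             \int[mu]_(t in ray) (w t * h t y)%:E)%E.
    by apply: eq_integral => t /set_mem rt; rewrite /w /h clamp_id// mulrC.
  have /(integrable_fin_num mray) If := integrable_modulus_integrand (polar r y) ef.
  rewrite -(fineK If) lee_fin; exact: modulus_hausdorff_le.
- move=> t; rewrite -integral_circle_EFin; last first.
    by apply: continuous_powR_nneg => // [s|]; [exact: modulus_ge0|exact: continuous_modulus_circle].
  under eq_integral do rewrite hE.
  apply: Lp_circle_mono => //; rewrite divr_ge0 ?(ltW (clamp_gt0 t))//=.
  by rewrite ler_pdivrMr ?clamp_gt0// ler_peMr.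
Qed.

(** For [p = +oo] the triangle inequality and the maximum principle play the
    parts of Minkowski's inequality and monotonicity. *)
Lemma circle_mean_hausdorff (p : \bar R) f (r : R) : (1 <= p)%E -> entire f -> 0 <= r ->
  (circle_mean p (hausdorff mu f) r <= K%:E * circle_mean p f r)%E.
Proof.
case: p => [p||//] p1 ef r0 /=; last first.
  apply: ge_ereal_sup => _ [z /= zr <-].
  have [M M0 MP] := entire_bounded_disc r ef.
  set S := ereal_sup _; have SM : (S <= M%:E)%E.
    by apply: ge_ereal_sup => _ [w /= wr <-]; rewrite lee_fin MP// wr.
  have fS w : modulus w = r -> ((modulus (f w))%:E <= S)%E.
    by move=> wr; apply: ereal_sup_ubound; exists w.
  have S0 : (0%:E <= S)%E.
    by apply: le_trans (fS z zr); rewrite lee_fin modulus_ge0.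
  have Sf : S \is a fin_num by rewrite ge0_fin_numE//; exact: le_lt_trans SM (ltry _).
  rewrite -(fineK Sf) -EFinM lee_fin.
  apply: le_trans (modulus_hausdorff_le z ef) _.
  rewrite mulrC -Rintegral_inv_ray; apply: le_Rintegral => //.
  - exact: integrable_modulus_integrand.
  - exact: integrable_inv_ray.
  - move=> t rt; have /andP[t0 _] := ray_inv rt; rewrite ler_wpM2r//.
    apply: (@maximum_principle _ f r) => //.
      by move=> w wr; rewrite -lee_fin fineK// fS.
    by rewrite -zr dilate_le.
rewrite lee_fin in p1; have p0 : 0 < p := lt_le_trans ltr01 p1.
have P0 : (0 <= (2 * pi)^-1 :> R) by rewrite invr_ge0 mulr_ge0 ?pi_ge0.
have -> : K%:E = ((K `^ p)%:E `^ p^-1)%E.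
  by rewrite poweR_EFin -powRrM mulfV ?gt_eqF// powRr1// weighted_mass_ge0.
have I0 g : (0 <= \int[lebesgue_measure]_(y in `[0%R, (2 * pi)%R])
   (modulus (g (polar r y)) `^ p)%:E)%E.
  by apply: integral_ge0 => y _; rewrite lee_fin powR_ge0.
rewrite -poweRM; last 2 first.
- by rewrite lee_fin powR_ge0.
- by rewrite mule_ge0// lee_fin.
apply: gt0_ler_poweR; rewrite ?invr_ge0 ?(ltW p0)//.
- by rewrite in_itv /= leey andbT mule_ge0// lee_fin.
- by rewrite in_itv /= leey andbT !mule_ge0// lee_fin ?powR_ge0.
rewrite muleCA lee_wpmul2l ?lee_fin//; exact: Lp_hausdorff.
Qed.

End HausdorffContraction.

(** * The mixed norm *)

(** The difference quotient of [phi] at 1 is bounded near 1. *)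
Lemma C1_bounded_right (R : realType) (phi : R -> R) : C1_on_nonneg phi ->
  exists B : R, exists2 e : R, (0 < e) & forall s, (1 < s < 1 + e) -> (phi s <= B).
Proof.
move=> [dphi [_ /(_ 1 ler01)]] /cvgrPdist_lt/(_ 1 ltr01).
rewrite /within /= nearE => -[e /= e0 He].
exists (phi 1 + (`|dphi 1| + 1) * e); exists e => // s /andP[s1 se].
have := He s; rewrite /ball_ /= distrC gtr0_norm ?subr_gt0// => H0.
have /H0 : (s - 1 < e) by rewrite ltrBlDl.
rewrite gt_eqF// => /(_ isT (le_trans ler01 (ltW s1))).
rewrite ltr_norml => /andP[H _].
have s0 : (0 < s - 1) by rewrite subr_gt0.
have : ((phi s - phi 1) / (s - 1) <= `|dphi 1| + 1).
  move: H; rewrite ltrBrDl -ltrBrDr opprK => /ltW/le_trans; apply.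
  by rewrite lerD2r ler_norm.
rewrite ler_pdivrMr// => H1.
have : ((`|dphi 1| + 1) * (s - 1) <= (`|dphi 1| + 1) * e).
  by rewrite ler_wpM2l ?addr_ge0// ltW// ltrBlDl.
lra.
Qed.

Section FockNorm.
Context {R : realType}.
Local Notation C := (R[i])%C.
Local Notation circle := `[0%R, (2 * pi)%R]%classic.
Implicit Types (f g : C -> C) (p q : \bar R) (phi : R -> R).
Local Open Scope ereal_scope.

Let pi2_gt0 : (0 < 2 * pi :> R)%R.
Proof. by rewrite mulr_gt0 ?pi_gt0. Qed.

Lemma circle_mean_ge0 p f (r : R) : 1 <= p -> (0 <= r)%R -> 0 <= circle_mean p f r.
Proof.
case: p => [p||//] p1 r0 /=; first exact: poweR_ge0.
apply: (@le_trans _ _ (modulus (f (polar r 0)))%:E).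
  by rewrite lee_fin modulus_ge0.
by apply: ereal_sup_ubound; exists (polar r 0) => //=; exact: modulus_polar.
Qed.

Lemma fock_norm_ge0 p q phi f : 1 <= p -> 1 <= q -> 0 <= fock_norm p q phi f.
Proof.
move=> p1; case: q => [q||//] q1 /=; first exact: poweR_ge0.
apply: (@le_trans _ _ (circle_mean p f 0 * (expR (- phi 0%R))%:E)).
  by rewrite mule_ge0 ?circle_mean_ge0// lee_fin expR_ge0.
by apply: ereal_sup_ubound; exists 0%R => //=; rewrite in_itv /= lexx.
Qed.

(** The norm depends on the function only through its circle means. When [c = 0]
    the right-hand side is 0 even if the norm of [g] is infinite. *)
Lemma le_fock_norm p q phi f g (c : R) : 1 <= p -> 1 <= q -> (0 <= c)%R ->
  (forall r : R, (0 <= r)%R -> circle_mean p f r <= c%:E * circle_mean p g r) ->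
  fock_norm p q phi f <= c%:E * fock_norm p q phi g.
Proof.
move=> p1 q1 c0 fg; case: q q1 => [q||//] q1 /=; last first.
  apply: ge_ereal_sup => _ [r /= + <-]; rewrite in_itv /= andbT => r0.
  apply: (@le_trans _ _ (c%:E * (circle_mean p g r * (expR (- phi r))%:E))).
    by rewrite muleA lee_wpmul2r ?lee_fin ?expR_ge0// fg.
  rewrite lee_wpmul2l ?lee_fin//; apply: ereal_sup_ubound; exists r => //=.
  by rewrite in_itv /= r0.
rewrite lee_fin in q1; have q0 : (0 < q)%R := lt_le_trans ltr01 q1.
have w0 (r : R) : (0 <= r)%R -> 0 <= (expR (- q * phi r) * r)%:E.
  by move=> r0; rewrite lee_fin mulr_ge0 ?expR_ge0.
have I0 h : 0 <= \int[lebesgue_measure]_(r in `[0%R, +oo[)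
    ((circle_mean p h r `^ q) * (expR (- q * phi r) * r)%:E).
  apply: integral_ge0 => r /=; rewrite in_itv /= andbT => r0.
  by rewrite mule_ge0 ?poweR_ge0 ?w0.
have fgq (r : R) : (0 <= r)%R ->
    circle_mean p f r `^ q <= (c `^ q)%:E * circle_mean p g r `^ q.
  move=> r0; rewrite -poweR_EFin -poweRM ?lee_fin ?circle_mean_ge0//.
  apply: gt0_ler_poweR; rewrite ?(ltW q0) ?fg// in_itv /= leey andbT ?circle_mean_ge0//.
  by rewrite mule_ge0 ?circle_mean_ge0// lee_fin.
have [c00|cn0] := eqVneq c 0%R.
  rewrite c00 mul0e integral0_eq ?poweR_EFin ?powR0 ?invr_neq0 ?gt_eqF// => r /=.
  rewrite in_itv /= andbT => r0.
  have := fgq r r0; rewrite c00 powR0 ?gt_eqF// mul0e => H.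
  have -> : circle_mean p f r `^ q = 0 by apply/le_anti; rewrite H poweR_ge0.
  by rewrite mul0e.
have cp : (0 < c)%R by rewrite lt_neqAle eq_sym cn0.
have -> : c%:E = (c `^ q)%:E `^ q^-1.
  by rewrite poweR_EFin -powRrM mulfV ?gt_eqF// powRr1.
rewrite -poweRM ?lee_fin ?powR_ge0//.
apply: gt0_ler_poweR; rewrite ?invr_ge0 ?(ltW q0)//.
- by rewrite in_itv /= leey andbT.
- by rewrite in_itv /= leey andbT mule_ge0// lee_fin powR_ge0.
apply: le_integral_scale; first by rewrite powR_gt0.
  move=> r /=; rewrite in_itv /= andbT => r0.
  by rewrite mule_ge0 ?poweR_ge0 ?w0.
move=> r /=; rewrite in_itv /= andbT => r0.
by rewrite muleA lee_wpmul2r ?w0// fgq.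
Qed.

Lemma circle_mean_scale p f (a : C) (r : R) : 1 <= p -> a != 0%R -> (0 <= r)%R ->
  circle_mean p (fun z => a * f z)%R r <= (modulus a)%:E * circle_mean p f r.
Proof.
case: p => [p||//] p1 a0 r0 /=; last first.
  apply: ge_ereal_sup => _ [z /= zr <-]; rewrite modulusM EFinM.
  rewrite lee_wpmul2l ?lee_fin ?modulus_ge0//.
  by apply: ereal_sup_ubound; exists z.
rewrite lee_fin in p1; have p0 : (0 < p)%R := lt_le_trans ltr01 p1.
have P0 : (0 <= (2 * pi)^-1 :> R)%R by rewrite invr_ge0 ltW.
have I0 g : 0 <= \int[lebesgue_measure]_(y in circle) (modulus (g (polar r y)) `^ p)%:E.
  by apply: integral_ge0 => y _; rewrite lee_fin powR_ge0.
have -> : (modulus a)%:E = (modulus a `^ p)%:E `^ p^-1.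
  by rewrite poweR_EFin -powRrM mulfV ?gt_eqF// powRr1// modulus_ge0.
rewrite -poweRM ?mule_ge0 ?lee_fin ?powR_ge0//.
apply: gt0_ler_poweR; rewrite ?invr_ge0 ?(ltW p0)//.
- rewrite in_itv /= leey andbT mule_ge0 ?lee_fin//.
  exact: (I0 (fun z => a * f z)%R).
- by rewrite in_itv /= leey andbT !mule_ge0// lee_fin ?powR_ge0.
rewrite muleCA lee_wpmul2l ?lee_fin//; apply: le_integral_scale.
- by rewrite powR_gt0// modulus_gt0.
- by move=> y _; rewrite lee_fin powR_ge0.
- by move=> y _; rewrite -EFinM lee_fin modulusM powRM ?modulus_ge0.
Qed.

(** The opposite inequality is [circle_mean_scale] for [a^-1]. *)
Lemma fock_norm_scale p q phi f (a : C) : 1 <= p -> 1 <= q -> a != 0%R ->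
  fock_norm p q phi (fun z => a * f z)%R = (modulus a)%:E * fock_norm p q phi f.
Proof.
move=> p1 q1 a0; have m0 : (0 < modulus a)%R by rewrite modulus_gt0.
apply/le_anti/andP; split.
  by apply: le_fock_norm => // [|r r0]; [exact: ltW|exact: circle_mean_scale].
rewrite -lee_pdivlMl//.
have := @le_fock_norm p q phi f (fun z => a * f z)%R (modulus a)^-1%R p1 q1.
apply=> [|r r0]; first by rewrite invr_ge0 ltW.
have := @circle_mean_scale p (fun z => a * f z)%R a^-1%R r p1 _ r0.
rewrite invr_eq0 modulusV => /(_ a0); congr (circle_mean _ _ _ <= _).
by apply/funext => z; rewrite mulKf.
Qed.

Lemma circle_mean_monomial_ge1 p n (r : R) : 1 <= p -> (1 <= r)%R ->
  1 <= circle_mean p (fun z => z ^+ n)%R r.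
Proof.
case: p => [p||//] p1 r1 /=; have r0 : (0 <= r)%R := le_trans ler01 r1; last first.
  apply: (@le_trans _ _ (modulus (polar r 0 ^+ n)%R)%:E).
    by rewrite lee_fin modulusX modulus_polar// exprn_ege1.
  by apply: ereal_sup_ubound; exists (polar r 0) => //=; exact: modulus_polar.
rewrite lee_fin in p1; have p0 : (0 < p)%R := lt_le_trans ltr01 p1.
have -> : 1 = 1 `^ p^-1 :> \bar R by rewrite poweR1r.
have P0 : (0 <= (2 * pi)^-1 :> R)%R by rewrite invr_ge0 ltW.
have H : 1 <= (2 * pi)^-1%:E *
    \int[lebesgue_measure]_(y in circle) (modulus (polar r y ^+ n)%R `^ p)%:E.
  rewrite lee_pdivlMl// mule1.
  apply: (@le_trans _ _ (\int[lebesgue_measure]_(y in circle) (cst 1 y))).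
    rewrite integral_cst//= mul1e lebesgue_measure_itv /= lte_fin pi2_gt0.
    by rewrite sube0.
  apply: le_integral_ge0 => y _; rewrite ?lee_fin//.
  rewrite modulusX modulus_polar//.
  have {1}-> : (1 = 1 `^ p :> R)%R by rewrite powR1.
  apply: ge0_ler_powR.
  - exact: ltW.
  - by rewrite nnegrE.
  - by rewrite nnegrE exprn_ge0.
  - exact: exprn_ege1.
apply: gt0_ler_poweR => //; rewrite ?invr_ge0 ?(ltW p0)// in_itv /= leey andbT//.
exact: le_trans H.
Qed.

(** The circle means are at least 1 for radii at least 1, and the weight is
    bounded below on an interval to the right of 1. *)
Lemma fock_norm_monomial_gt0 p q phi n : 1 <= p -> 1 <= q -> is_weight q phi ->
  0 < fock_norm p q phi (fun z => z ^+ n)%R.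
Proof.
move=> p1 q1 [_ /C1_bounded_right[B [e e0 phiB]] _].
case: q q1 => [q||//] q1 /=; last first.
  apply: (@lt_le_trans _ _ (expR (- phi 1%R))%:E); first by rewrite lte_fin expR_gt0.
  apply: (@le_trans _ _ (circle_mean p (fun z => z ^+ n)%R 1 * (expR (- phi 1%R))%:E)).
    by rewrite lee_pemull ?lee_fin ?expR_ge0// circle_mean_monomial_ge1.
  by apply: ereal_sup_ubound; exists 1%R => //=; rewrite in_itv /= ler01.
rewrite lee_fin in q1; have q0 : (0 < q)%R := lt_le_trans ltr01 q1.
set I := integral _ _ _.
suff I0 : 0 < I.
  rewrite lt_neqAle poweR_ge0 andbT eq_sym poweR_eq0 ?(ltW I0)//.
  by rewrite gt_eqF.
pose A := `]1%R, (1 + e)%R[%classic : set R.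
apply: (@lt_le_trans _ _ ((expR (- q * B))%:E * e%:E)).
  by rewrite -EFinM lte_fin mulr_gt0 ?expR_gt0.
have <- : \int[lebesgue_measure]_(r in `[0%R, +oo[) ((cst (expR (- q * B))%:E \_ A) r) =
   (expR (- q * B))%:E * e%:E.
  rewrite -integral_mkcondr setIidr.
    rewrite integral_cst /A; last exact: measurable_itv.
    congr (_ * _); apply: etrans (lebesgue_measure_itv `]1%R, (1 + e)%R[) _.
    by rewrite /= lte_fin ltrDl e0 -EFinB addrAC subrr add0r.
  by move=> x /=; rewrite !in_itv /= andbT => /andP[/ltW x1 _]; exact: le_trans x1.
apply: le_integral_ge0 => r /=; rewrite in_itv /= andbT => r0; rewrite patchE.
  by case: ifPn => // _; rewrite lee_fin expR_ge0.
case: ifPn => [|_]; last first.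
  by rewrite mule_ge0 ?poweR_ge0// lee_fin mulr_ge0 ?expR_ge0.
move=> /set_mem; rewrite /A /= in_itv /= => rA; have /andP[r1 _] := rA.
apply: (@le_trans _ _ (1 * (expR (- q * phi r) * r)%:E)).
  rewrite mul1e lee_fin -[leLHS]mulr1; apply: ler_pM; rewrite ?expR_ge0// ?(ltW r1)//.
  by rewrite ler_expR !mulNr lerN2 ler_pM2l// phiB.
apply: lee_wpmul2r; first by rewrite lee_fin mulr_ge0 ?expR_ge0.
have -> : 1 = 1 `^ q :> \bar R by rewrite poweR1r.
have H := circle_mean_monomial_ge1 n p1 (ltW r1).
apply: gt0_ler_poweR => //; rewrite ?(ltW q0)// in_itv /= leey andbT//.
exact: le_trans H.
Qed.

End FockNorm.

(** * Action on monomials *)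

Section HausdorffMonomials.
Context {R : realType}.
Local Notation C := (R[i])%C.
Variable mu : {measure set (measurableTypeR R) -> \bar R}.
Local Notation ray := `[1%R, +oo[%classic.
Local Notation pos := `]0%R, +oo[%classic.
Implicit Types (n m : nat) (a : C).

Let mpos : measurable (pos : set (measurableTypeR R)).
Proof. exact: measurable_itv. Qed.

(** The eigenvalue of the Hausdorff operator at the monomial of degree [n]. *)
Definition moment n : R := \int[mu]_(t in pos) (t^-1 ^+ n.+1).

Let pos_gt0 (t : R) : pos t -> 0 < t.
Proof. by rewrite /= in_itv /= andbT. Qed.

Lemma moment_ge0 n : 0 <= moment n.
Proof.
by apply: Rintegral_ge0 => t /pos_gt0 t0; rewrite exprn_ge0// invr_ge0 ltW.
Qed.

Lemma integrand_monomial n a z (t : R) :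
  hausdorff_integrand (fun w => a * w ^+ n) z t = (a * z ^+ n) * (t^-1 ^+ n.+1)%:C%C.
Proof. rewrite /hausdorff_integrand -fmorphV exprMn rmorphXn /= exprS; ring. Qed.

Lemma integrable_moment n : hausdorff_defined mu (fun z : C => z ^+ n) ->
  mu.-integrable pos (fun t => (t^-1 ^+ n.+1)%:E).
Proof.
move=> /(_ 1) [H _]; move: H; congr (mu.-integrable _ _); apply/funext => t.
suff -> : hausdorff_integrand (fun z : C => z ^+ n) 1 t = (t^-1 ^+ n.+1)%:C%C by [].
by rewrite /hausdorff_integrand mul1r -fmorphV -rmorphXn -rmorphM /= -exprS.
Qed.

Lemma hausdorff_monomial n a : hausdorff_defined mu (fun z : C => z ^+ n) ->
  hausdorff mu (fun z => a * z ^+ n) = (fun z => (moment n)%:C%C * a * z ^+ n).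
Proof.
move=> /integrable_moment im; apply/funext => z.
transitivity (cintegral mu pos (fun t => (a * z ^+ n) * (t^-1 ^+ n.+1)%:C%C)).
  by congr cintegral; apply/funext => t; exact: integrand_monomial.
have ic : cintegrable mu pos (fun t => (t^-1 ^+ n.+1)%:C%C).
  by split => //=; exact: integrable0.
rewrite cintegralZ// mulrC -mulrA; congr (_ * _).
apply/eqP; rewrite eq_complex /= eqxx /=; apply/eqP.
by rewrite /Rintegral integral0.
Qed.

Lemma iter_hausdorff_monomial n m a : hausdorff_defined mu (fun z : C => z ^+ n) ->
  iter m (hausdorff mu) (fun z => a * z ^+ n) =
  (fun z => (moment n)%:C%C ^+ m * a * z ^+ n).
Proof.
move=> dn; elim: m => [|m IH] /=; first by apply/funext => z; rewrite expr0 mul1r.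
by rewrite IH hausdorff_monomial//; apply/funext => z; rewrite exprS mulrA.
Qed.

(** Bernoulli's inequality makes the powers of [c > 1] unbounded. *)
Lemma exprn_bounded_le1 (c B : R) : (forall m, c ^+ m <= B) -> c <= 1.
Proof.
move=> cB; rewrite leNgt; apply/negP => c1.
have bern m : 1 + m%:R * (c - 1) <= c ^+ m.
  elim: m => [|m IH]; first by rewrite mul0r addr0 expr0.
  have c0 : 0 <= c by lra.
  rewrite exprS; apply: le_trans (ler_wpM2l c0 IH).
  rewrite -natr1; have : 0 <= m%:R * (c - 1) ^+ 2 by rewrite mulr_ge0// sqr_ge0.
  nra.
have c1' : 0 < c - 1 by lra.
have B1 := cB 0%N; rewrite expr0 in B1.
have := archi_boundP (divr_ge0 (le_trans ler01 B1) (ltW c1')).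
rewrite ltr_pdivrMr//; have := bern (Num.Def.archi_bound (B / (c - 1))).
by have := cB (Num.Def.archi_bound (B / (c - 1))); lra.
Qed.

(** On [(0, x]] with [x < 1] the integrand of the [n]-th moment is at least
    [x^-(n+1)], so bounded moments force this interval to be null. *)
Lemma moments_bounded_null : (forall n, mu.-integrable pos (fun t => (t^-1 ^+ n.+1)%:E)) ->
  (forall n, moment n <= 1) -> mu `]0%R, 1%R[%classic = 0%E.
Proof.
move=> im m1.
have null (x : R) : 0 < x < 1 -> mu (`]0%R, x]%classic) = 0%E.
  move=> /andP[x0 x1]; set A := `]0%R, x]%classic.
  have mA : measurable (A : set (measurableTypeR R)) by exact: measurable_itv.
  have H n : (mu A <= (x ^+ n.+1)%:E)%E.
    have xn : 0 < x^-1 ^+ n.+1 by rewrite exprn_gt0// invr_gt0.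
    have -> : x ^+ n.+1 = (x^-1 ^+ n.+1)^-1 by rewrite exprVn invrK.
    rewrite -[(_^-1)%:E]mule1 lee_pdivlMl//.
    rewrite -integral_cst//.
    apply: (@le_trans _ _ (\int[mu]_(t in pos) (t^-1 ^+ n.+1)%:E)%E); last first.
      have := m1 n; rewrite /moment /Rintegral -lee_fin fineK//.
      exact: integrable_fin_num (im n).
    apply: (@le_trans _ _ (\int[mu]_(t in A) (t^-1 ^+ n.+1)%:E)%E).
      apply: le_integral_ge0 => t; first by rewrite lee_fin ltW.
      rewrite /A /= in_itv /= => /andP[t0 tx]; rewrite lee_fin lerXn2r//.
      - by rewrite nnegrE invr_ge0 ltW.
      - by rewrite nnegrE invr_ge0 ltW.
      - by rewrite lef_pV2.
    apply: ge0_subset_integral => //.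
    - exact: measurable_int (im n).
    - by move=> t /pos_gt0 t0; rewrite lee_fin exprn_ge0// invr_ge0 ltW.
    - by move=> t; rewrite /A /= !in_itv /= andbT => /andP[].
  apply/le_anti; rewrite measure_ge0 andbT; apply/lee_addgt0Pr => e e0.
  rewrite add0e; have /cvgrPdist_lt/(_ _ e0) : x ^+ n @[n --> \oo] --> (0 : R).
    by apply: cvg_expr; rewrite gtr0_norm.
  move=> [N _ NP]; have := NP N.+1 (leqnSn N); rewrite /= sub0r normrN => xe.
  apply: le_trans (H N) _; rewrite lee_fin; apply: le_trans (ltW xe).
  exact: ler_norm.
(* With [k.+2] all the right end points are positive. *)
pose F (k : nat) := `]0%R, (1 - k.+2%:R^-1)]%classic : set (measurableTypeR R).
have k1 (k : nat) : 0 < (1 - k.+2%:R^-1 : R) < 1.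
  by rewrite subr_gt0 invf_lt1 ?ltr1n//= ltrBlDr ltrDl invr_gt0.
have mF k : measurable (F k) by exact: measurable_itv.
have UF : `]0%R, 1%R[%classic = \bigcup_k F k.
  apply/seteqP; split => t /=.
    rewrite in_itv /= => /andP[t0 t1].
    have t1' : 0 < 1 - t by rewrite subr_gt0.
    have [k] : exists k : nat, k.+2%:R^-1 <= 1 - t.
      exists (Num.Def.archi_bound (1 - t)^-1).
      rewrite invf_ple ?posrE//; have := archi_boundP (ltW (divr_gt0 ltr01 t1')).
      rewrite div1r => /ltW/le_trans; apply; rewrite ler_nat.
      by rewrite -addn2 leq_addr.
    by move=> kt; exists k => //; rewrite /F /= in_itv /= t0 /= lerBrDr addrC -lerBrDr.
  move=> [k _]; rewrite /F /= !in_itv /= => /andP[t0 tk]; rewrite t0 /=.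
  by have /andP[_] := k1 k; exact: le_lt_trans.
have [N [mN N0 UN]] : mu.-negligible (\bigcup_k F k).
  apply: negligible_bigcup => k; exists (F k); split => //; exact: null.
rewrite UF; apply/le_anti; rewrite measure_ge0 andbT -N0; apply: le_measure; rewrite ?inE//.
exact: bigcup_measurable.
Qed.

End HausdorffMonomials.

(** * Power boundedness, contractivity and the measure *)

Section Main.
Context {R : realType}.
Local Notation C := (R[i])%C.
Local Notation ray := `[1%R, +oo[%classic.
Local Notation pos := `]0%R, +oo[%classic.
Variable mu : {measure set (measurableTypeR R) -> \bar R}.
Variables (p q : \bar R) (phi : R -> R).
Hypotheses (p1 : (1 <= p)%E) (q1 : (1 <= q)%E) (hphi : is_weight q phi).
Hypothesis hpoly : forall n : nat, fock p q phi (fun z : C => z ^+ n).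
Local Notation nrm := (fock_norm p q phi).

Lemma entire_scale f (a : C) : entire f -> entire (fun z => a * f z).
Proof.
move=> /entireP ef; apply/entireP => z; have [d fd] := ef z.
by exists (a * d); exact: cdiffZ.
Qed.

(** Test the operator on the monomial normalized to have norm one. *)
Lemma operator_norm_ge_moment n m : hausdorff_defined mu (fun z : C => z ^+ n) ->
  ((moment mu n ^+ m)%:E <= fock_operator_norm p q phi (iter m (hausdorff mu)))%E.
Proof.
move=> dn; have [en Noo] := hpoly n.
have N0 := fock_norm_monomial_gt0 n p1 q1 hphi.
set N := nrm _ in Noo N0; have Nf : N \is a fin_num by rewrite ge0_fin_numE// ltW.
have NE : N = (fine N)%:E by rewrite fineK.
have N1 : 0 < fine N by rewrite -lte_fin -NE.
pose a : C := ((fine N)^-1)%:C%C.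
have a0 : a != 0 by rewrite -modulus_gt0 modulus_nneg ?invr_ge0 ?invr_gt0// ltW.
have ma : modulus a = (fine N)^-1 by rewrite modulus_nneg// invr_ge0 ltW.
have na : nrm (fun z => a * z ^+ n) = 1%E.
  by rewrite fock_norm_scale// ma -/N NE -EFinM mulVf// gt_eqF.
have Fa : fock p q phi (fun z => a * z ^+ n).
  by split; [exact: entire_scale|rewrite na ltry].
apply: (@le_trans _ _ (nrm (iter m (hausdorff mu) (fun z => a * z ^+ n)))); last first.
  by apply: ereal_sup_ubound; exists (fun z => a * z ^+ n) => //; rewrite /= na.
have [c0|c0] := eqVneq (moment mu n ^+ m) 0.
  by rewrite c0 fock_norm_ge0.
rewrite iter_hausdorff_monomial//.
have -> : (fun z : C => (moment mu n)%:C%C ^+ m * a * z ^+ n) =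
   (fun z => (moment mu n ^+ m)%:C%C * (a * z ^+ n)).
  by apply/funext => z; rewrite rmorphXn /= mulrA.
have c1 : 0 <= moment mu n ^+ m by rewrite exprn_ge0// moment_ge0.
rewrite fock_norm_scale//; last first.
  by rewrite -modulus_gt0 modulus_nneg// lt_neqAle eq_sym c0.
by rewrite na mule1 modulus_nneg.
Qed.

Lemma moments_bounded_measure :
  (forall n, hausdorff_defined mu (fun z : C => z ^+ n)) ->
  (forall n, moment mu n <= 1) ->
  mu `]0%R, 1%R[%classic = 0%E /\ (\int[mu]_(t in ray) (t^-1)%:E <= 1)%E.
Proof.
move=> dn m1; split.
  by apply: moments_bounded_null => // n; exact: integrable_moment.
have i0 := integrable_moment (dn 0%N).
have mpos : measurable (pos : set (measurableTypeR R)) by exact: measurable_itv.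
have H : (\int[mu]_(t in pos) (t^-1 ^+ 1)%:E <= 1)%E.
  have := m1 0%N; rewrite /moment /Rintegral -lee_fin fineK//.
  exact: integrable_fin_num i0.
apply: le_trans H; apply: ge0_subset_integral => //.
- exact: measurable_int i0.
- by move=> t; rewrite /= in_itv /= andbT => t0; rewrite lee_fin invr_ge0 ltW.
- by move=> t; rewrite /= !in_itv /= !andbT; exact: lt_le_trans.
Qed.

(** A bound on all powers of the operator bounds all powers of each moment, and
    hence each moment by 1. *)
Lemma power_bounded_measure : hausdorff_power_bounded p q phi mu ->
  mu `]0%R, 1%R[%classic = 0%E /\ (\int[mu]_(t in ray) (t^-1)%:E <= 1)%E.
Proof.
move=> [[df _] pb]; have dn n := df _ (hpoly n).
apply: moments_bounded_measure => // n.
set S := ereal_sup _ in pb.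
have cS m : ((moment mu n ^+ m)%:E <= S)%E.
  apply: le_trans (operator_norm_ge_moment m (dn n)) _.
  by apply: ereal_sup_ubound; exists m.
have Sf : S \is a fin_num.
  rewrite ge0_fin_numE//; apply: le_trans _ (cS 0%N).
  by rewrite expr0 lee_fin.
by apply: (@exprn_bounded_le1 _ _ (fine S)) => m; rewrite -lee_fin fineK.
Qed.

Lemma contraction_measure : hausdorff_contraction p q phi mu ->
  mu `]0%R, 1%R[%classic = 0%E /\ (\int[mu]_(t in ray) (t^-1)%:E <= 1)%E.
Proof.
move=> [[df _] pb]; have dn n := df _ (hpoly n).
apply: moments_bounded_measure => // n.
by have := le_trans (operator_norm_ge_moment 1 (dn n)) pb; rewrite expr1 lee_fin.
Qed.

(** The upper bound is the comparison of circle means, iterated; the lower bound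
    is attained at the constants, which are multiplied by the moment of order
    0, equal to the integral of [1 / t] when [(0, 1)] is null. *)
Lemma operator_norm_iter_hausdorff : mu `]0%R, 1%R[%classic = 0%E ->
  (\int[mu]_(t in ray) (t^-1)%:E <= 1)%E ->
  hausdorff_bounded p q phi mu /\ forall n,
    (fock_operator_norm p q phi (iter n (hausdorff mu)) =
    (\int[mu]_(t in ray) (t^-1)%:E) ^+ n)%E.
Proof.
move=> mu01 Kle; set I := (\int[mu]_(t in ray) _)%E in Kle *.
have I0 : (0 <= I)%E.
  apply: integral_ge0 => t; rewrite /= in_itv /= andbT => t1.
  by rewrite lee_fin invr_ge0 (le_trans ler01).
have If : I \is a fin_num by rewrite ge0_fin_numE// (le_lt_trans Kle)// ltry.
pose K := fine I; have muK : I = K%:E by rewrite fineK.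
have K0 : 0 <= K by rewrite -lee_fin -muK.
have nH f : entire f -> (nrm (hausdorff mu f) <= K%:E * nrm f)%E.
  by move=> ef; apply: le_fock_norm => // r r0; exact: circle_mean_hausdorff.
have FH f : fock p q phi f -> fock p q phi (hausdorff mu f).
  move=> [ef nf]; split; first exact: (entire_hausdorff mu01 muK).
  apply: le_lt_trans (nH f ef) _; have nf0 := fock_norm_ge0 phi f p1 q1.
  have nff : nrm f \is a fin_num by rewrite ge0_fin_numE.
  by rewrite -(fineK nff) -EFinM ltry.
have bH : hausdorff_bounded p q phi mu.
  split; first by move=> f [ef _]; case: (hausdorff_ray mu01 muK 0 ef).
  split => //; last by exists K => f [ef _]; exact: nH.
  by move=> a f g [ef _] [eg _]; exact: (hausdorff_linear mu01 muK).
split => // n; rewrite muK -EFin_expe.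
have it m f : fock p q phi f ->
    fock p q phi (iter m (hausdorff mu) f) /\
    (nrm (iter m (hausdorff mu) f) <= (K ^+ m)%:E * nrm f)%E.
  move=> Ff; elim: m => [|m [Fm Nm]] /=; first by rewrite expr0 mul1e.
  split; first exact: FH.
  apply: le_trans (nH _ Fm.1) _; rewrite exprS EFinM -muleA.
  by rewrite lee_wpmul2l ?lee_fin.
apply/le_anti/andP; split.
  apply: ge_ereal_sup => _ [f /= [Ff f1] <-].
  have [_] := it n f Ff; move=> /le_trans; apply.
  by rewrite -[leRHS]mule1 lee_wpmul2l// lee_fin exprn_ge0.
have d0 := bH.1 _ (hpoly 0%N).
suff <- : moment mu 0 = K by exact: operator_norm_ge_moment.
have i0 := integrable_moment d0.
have mpos : measurable (pos : set (measurableTypeR R)) by exact: measurable_itv.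
have mi : measurable_fun (pos : set (measurableTypeR R)) (fun t : R => t^-1 ^+ 1).
  by apply/measurable_EFinP; exact: measurable_int i0.
have ir : mu.-integrable ray (EFin \o (fun t : R => t^-1 ^+ 1)).
  apply: integrableS i0 => //.
  by move=> t; rewrite /= !in_itv /= !andbT; exact: lt_le_trans.
have [_ H] := integrable_pos_ray mu01 mi ir.
by rewrite /moment H /Rintegral /K.
Qed.

End Main.

Theorem theorem8 (R : realType)
    (mu : {measure set (measurableTypeR R) -> \bar R})
    (p q : \bar R) (hp : (1 <= p)%E) (hq : (1 <= q)%E)
    (phi : R -> R) (hphi : is_weight q phi)
    (hpoly : forall n : nat, fock p q phi (fun z : (R[i])%C => z ^+ n)) :
  (hausdorff_power_bounded p q phi mu <-> hausdorff_contraction p q phi mu) /\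
  (hausdorff_contraction p q phi mu <->
     mu `]0%R, 1%R[%classic = 0%E /\ (\int[mu]_(t in `[1%R, +oo[) (t^-1)%:E <= 1)%E) /\
  (hausdorff_power_bounded p q phi mu ->
     forall n : nat,
       fock_operator_norm p q phi (iter n (hausdorff mu))
         = (fock_operator_norm p q phi (hausdorff mu) ^+ n)%E /\
       (fock_operator_norm p q phi (hausdorff mu) ^+ n)%E
         = ((\int[mu]_(t in `[1%R, +oo[) (t^-1)%:E) ^+ n)%E).
Proof.
set I := (\int[mu]_(t in _) _)%E.
have I0 : (0 <= I)%E.
  apply: integral_ge0 => t; rewrite /= in_itv /= andbT => t1.
  by rewrite lee_fin invr_ge0 (le_trans ler01).
have norm1 : (forall n, fock_operator_norm p q phi (iter n (hausdorff mu)) = I ^+ n)%E ->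
    fock_operator_norm p q phi (hausdorff mu) = I.
  by move=> /(_ 1%N).
have iii_ii : mu `]0%R, 1%R[%classic = 0%E /\ (I <= 1)%E -> hausdorff_contraction p q phi mu.
  move=> [mu0 I1]; have [bH nH] := operator_norm_iter_hausdorff hp hq hphi hpoly mu0 I1.
  by split => //; rewrite (norm1 nH).
have iii_i : mu `]0%R, 1%R[%classic = 0%E /\ (I <= 1)%E -> hausdorff_power_bounded p q phi mu.
  move=> [mu0 I1]; have [bH nH] := operator_norm_iter_hausdorff hp hq hphi hpoly mu0 I1.
  split => //; apply: (@le_lt_trans _ _ 1%E); last exact: ltry.
  apply: ge_ereal_sup => _ [n _ <-]; rewrite nH -/I.
  have If : I \is a fin_num by rewrite ge0_fin_numE// (le_lt_trans I1)// ltry.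
  rewrite -(fineK If) -EFin_expe lee_fin exprn_ile1 -?lee_fin ?fineK//.
split; [|split].
- split; first by move/(power_bounded_measure hp hq hphi hpoly).
  by move/(contraction_measure hp hq hphi hpoly).
- by split=> //; exact: contraction_measure.
move=> /(power_bounded_measure hp hq hphi hpoly)[mu0 I1] n.
have [_ nH] := operator_norm_iter_hausdorff hp hq hphi hpoly mu0 I1.
by rewrite nH (norm1 nH).
Qed.
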